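(* Let $I\subseteq\mathbb{R}$ be a nonempty open interval and let $f:I\to\mathbb{R}$ be strictly increasing. Then the following conditions are equivalent. (a) For all $n\in\mathbb{N}$ and for all $(x_1,\dots,x_n),(y_1,\dots,y_n)\in I^n$, $$A^{[n]}_{f}\Big(\frac{x_1+y_1}{2},\dots,\frac{x_n+y_n}{2}\Big)\leq \frac{1}{2}\Big(A^{[n]}_{f}(x_1,\dots,x_n)+A^{[n]}_{f}(y_1,\dots,y_n)\Big).$$ (b) For all $n\in\mathbb{N}$, for all $(x_1,\dots,x_n),(y_1,\dots,y_n)\in I^n$, and for all $(\lambda_1,\dots,\lambda_n)\in\Lambda_n$, $$\widetilde{A}^{[n]}_{f}\Big(\frac{x_1+y_1}{2},\dots,\frac{x_n+y_n}{2};\lambda_1,\dots,\lambda_n\Big)\leq \frac{1}{2}\Big(\widetilde{A}^{[n]}_{f}(x_1,\dots,x_n;\lambda_1,\dots,\lambda_n)+\widetilde{A}^{[n]}_{f}(y_1,\dots,y_n;\lambda_1,\dots,\lambda_n)\Big).$$ (c) For all $(x_1,x_2),(y_1,y_2)\in I^2$, $$A^{[2]}_{f}\Big(\frac{x_1+y_1}{2},\frac{x_2+y_2}{2}\Big)\leq \frac{1}{2}\Big(A^{[2]}_{f}(x_1,x_2)+A^{[2]}_{f}(y_1,y_2)\Big).$$ (d) The function $f$ is continuous and the function $\Psi:f(I)^2\to\mathbb{R}$ defined by $$\Psi(u,v):=f\bigg(\frac{f^{-1}(u)+f^{-1}(v)}{2}\bigg)$$ is concave. (e) $f$ is twice continuously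 differentiable with a positive first derivative and either $f''=0$ on $I$, or $f''$ is positive on $I$ and $\frac{f'}{f''}$ is concave.
   Context: Conventions: $\mathbb{N}=\{1,2,\dots\}$; ''increasing'' means nondecreasing (as opposed to ''strictly increasing''). $\operatorname{conv}(S)$ is the convex hull of $S\subseteq\mathbb{R}$. Weights: $\Lambda_n:=[0,\infty)^n\setminus\{(0,\dots,0)\}$. Generalized inverse: if $I\subseteq\mathbb{R}$ is a nonempty open interval and $f:I\to\mathbb{R}$ is strictly increasing (not necessarily continuous), then there is a unique increasing function $f^{(-1)}:\operatorname{conv}(f(I))\to I$ with $f^{(-1)}(f(x))=x$ for all $x\in I$; it is called the generalized inverse of $f$ (it is continuous and satisfies $f(f^{(-1)}(y))=y$ for $y\in f(I)$). Generalized quasi-arithmetic means: for such $f$ and $n\in\mathbb{N}$, $$A^{[n]}_{f}(x_1,\dots,x_n):=f^{(-1)}\Big(\frac{f(x_1)+\dots+f(x_n)}{n}\Big)\quad (x\in I^n),$$ $$\widetilde{A}^{[n]}_{f}(x_1,\dots,x_n;\lambda_1,\dots,\lambda_n):=f^{(-1)}\Big(\frac{\lambda_1f(x_1)+\dots+\lambda_nf(x_n)}{\lambda_1+\dots+\lambda_n}\Big)\quad (x\in I^n,\ \lambda\in\Lambda_n).$$ *)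

(* Defs.v *)
From HB Require Import structures.
From mathcomp Require Import all_boot all_order all_algebra.
From mathcomp Require Import all_classical all_reals all_analysis.

Set Implicit Arguments.
Unset Strict Implicit.
Unset Printing Implicit Defensive.

Import Order.TTheory GRing.Theory Num.Theory.
Import numFieldNormedType.Exports.

Local Open Scope classical_set_scope.
Local Open Scope ring_scope.

(* A function f : I -> R is represented by a total f : R -> R of which only
   the restriction to I is ever used. *)

Definition strictly_increasing_on (R : realType) (I : set R) (f : R -> R) :=
  forall x y, I x -> I y -> x < y -> f x < f y.

Definition increasing_on (R : realType) (D : set R) (g : R -> R) :=
  forall x y, D x -> D y -> x <= y -> g x <= g y.

Definition conv_hull (R : realType) (S : set R) : set R :=
  smallest (@convex_set R R^o) S.

Definition is_gen_inverse (R : realType) (I : set R) (f g : R -> R) :=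
  [/\ forall y, conv_hull (f @` I) y -> I (g y),
      increasing_on (conv_hull (f @` I)) g
    & forall x, I x -> g (f x) = x].

(* Existence, and uniqueness on conv (f I), are gen_inv_spec and
   gen_inverse_unique below; the values off conv (f I) are arbitrary. *)
Definition gen_inv (R : realType) (I : set R) (f : R -> R) : R -> R :=
  xget (fun=> 0) [set g | is_gen_inverse I f g].

Definition qa_mean (R : realType) (I : set R) (f : R -> R) (n : nat)
    (x : 'I_n -> R) : R :=
  gen_inv I f ((\sum_(i < n) f (x i)) / n%:R).

Definition weights (R : realType) (n : nat) : set ('I_n -> R) :=
  [set l | (forall i, 0 <= l i) /\ (exists i, l i != 0)].

Definition weighted_qa_mean (R : realType) (I : set R) (f : R -> R) (n : nat)
    (x l : 'I_n -> R) : R :=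
  gen_inv I f ((\sum_(i < n) l i * f (x i)) / (\sum_(i < n) l i)).

Definition concave_on (R : realType) (E : lmodType R) (D : set E)
    (g : E -> R) :=
  @convex_set R E D /\ @convex_function R E D (fun x => - g x).

Definition Psi (R : realType) (I : set R) (f : R -> R) (p : R^o * R^o) : R :=
  let finv := 'pinv_(fun=> 0) I f in
  f ((finv p.1 + finv p.2) / 2).

Definition continuously_differentiable_on (R : realType) (k : nat) (I : set R)
    (f : R -> R) :=
  (forall j, (j < k)%N -> forall x, I x -> derivable (derive1n j f) x 1) /\
  {within I, continuous (derive1n k f)}.

Section gen_inverse_theory.
Variables (R : realType) (I : set R) (f : R -> R).
Hypotheses (itvI : is_interval I) (f_incr : strictly_increasing_on I f).

Lemma conv_hull_image_bounds y : conv_hull (f @` I) y ->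
  exists2 ab : R * R, I ab.1 /\ I ab.2 & f ab.1 <= y <= f ab.2.
Proof.
pose D := [set z | exists2 ab : R * R, I ab.1 /\ I ab.2
  & f ab.1 <= z <= f ab.2].
apply: (smallest_sub (C := @convex_set R R^o) (X := D)).
- move=> /= u v t /set_mem[[a b]/= [Ia Ib] /andP[au ub]].
  move=> /set_mem[[c d]/= [Ic Id] /andP[cv vd]].
  apply/mem_set; change (D (t%:num * u + (1 - t%:num) * v)); rewrite /D /=.
  have mono p q : I p -> I q -> p <= q -> f p <= f q.
    by move=> Ip Iq; rewrite le_eqVlt => /predU1P[->//|/f_incr/ltW]; apply.
  have [m [Im ma mc]] : exists m, [/\ I m, f m <= f a & f m <= f c].
    by have [ac|/ltW ca] := leP a c; [exists a|exists c]; split=> //;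
      exact: mono.
  have [M [IM bM dM]] : exists M, [/\ I M, f b <= f M & f d <= f M].
    by have [bd|/ltW db] := leP b d; [exists d|exists b]; split=> //;
      exact: mono.
  exists (m, M) => //=.
  have t0 : 0 <= t%:num by [].
  have t1 : 0 <= (1 - t%:num) by rewrite subr_ge0.
  have E z : z = t%:num * z + (1 - t%:num) * z.
    by rewrite -mulrDl addrC subrK mul1r.
  rewrite [f m]E [f M]E; apply/andP; split; apply: lerD;
    apply: ler_wpM2l => //; [exact: le_trans au|exact: le_trans cv
    |exact: le_trans bM|exact: le_trans dM].
- by move=> _ [x Ix <-]; exists (x, x) => //=; rewrite lexx.
Qed.

Lemma conv_hull_image x : I x -> conv_hull (f @` I) (f x).
Proof. by move=> Ix; apply: sub_gen_smallest; exists x. Qed.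

Lemma gen_inverse_exists : exists g, is_gen_inverse I f g.
Proof.
pose L y := [set x | I x /\ f x <= y].
have ubL y b : I b -> y <= f b -> ubound (L y) b.
  move=> Ib yb x [Ix xy]; rewrite leNgt; apply/negP => /(f_incr Ib Ix).
  by rewrite ltNge (le_trans xy yb).
have supL y : conv_hull (f @` I) y -> has_sup (L y).
  move=> /conv_hull_image_bounds[[a b]/= [Ia Ib] /andP[ay yb]].
  by split; [exists a|exists b; exact: ubL].
exists (fun y => sup (L y)); split.
- move=> y Cy; have [L0 Lb] := supL _ Cy.
  have [[a b]/= [Ia Ib] /andP[ay yb]] := conv_hull_image_bounds Cy.
  apply: (itvI Ia Ib); apply/andP; split.
    exact: (ub_le_sup Lb).
  exact: (ge_sup L0 (ubL _ _ Ib yb)).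
- move=> y z Cy Cz yz; apply: ge_sup; first by case: (supL _ Cy).
  move=> x [Ix xy]; apply: ub_le_sup; first by case: (supL _ Cz).
  by split=> //; exact: le_trans yz.
- move=> x Ix; have [L0 Lb] := supL _ (conv_hull_image Ix).
  apply/eqP; rewrite eq_le; apply/andP; split.
    exact: (ge_sup L0 (ubL _ _ Ix _)).
  exact: (ub_le_sup Lb).
Qed.

Lemma gen_inv_spec : is_gen_inverse I f (gen_inv I f).
Proof.
have [g Hg] := gen_inverse_exists.
exact: (@xgetPex _ (fun=> 0) [set g | is_gen_inverse I f g] (ex_intro _ g Hg)).
Qed.

Lemma gen_inverse_unique g h : is_gen_inverse I f g -> is_gen_inverse I f h ->
  forall y, conv_hull (f @` I) y -> g y = h y.
Proof.
have main g1 g2 y : is_gen_inverse I f g1 -> is_gen_inverse I f g2 ->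
    conv_hull (f @` I) y -> g1 y <= g2 y.
  move=> [I1 m1 K1] [I2 m2 K2] Cy; rewrite leNgt; apply/negP => lt21.
  have [l2 l1] : g2 y < (g2 y + g1 y) / 2 /\ (g2 y + g1 y) / 2 < g1 y.
    by rewrite !midf_lt.
  set z := _ / 2 in l1 l2.
  have Iz : I z by apply: (itvI (I2 _ Cy) (I1 _ Cy)); rewrite !ltW.
  have Cz := conv_hull_image Iz.
  have [yz|/ltW zy] := leP y (f z).
    by have := m1 _ _ Cy Cz yz; rewrite K1// leNgt l1.
  by have := m2 _ _ Cz Cy zy; rewrite K2// leNgt l2.
by move=> gi hi y Cy; apply/eqP; rewrite eq_le !main.
Qed.

End gen_inverse_theory.

(* Main.v *)
Require Import Defs.
From HB Require Import structures.
From mathcomp Require Import all_boot all_order all_algebra.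
From mathcomp Require Import all_classical all_reals all_analysis.
From mathcomp Require Import ring lra.

Set Implicit Arguments.
Unset Strict Implicit.
Unset Printing Implicit Defensive.

Import Order.TTheory GRing.Theory Num.Theory.
Import numFieldNormedType.Exports.

Local Open Scope classical_set_scope.
Local Open Scope ring_scope.

(** Write g for the inverse of f on f(I), so that concavity of Psi on a chord is
the inequality [Psi_concave].  The links are (a) => (c) => (d) => (b) => (a),
(b) => (c) and (d) <=> (e).

(c) => (d).  If f jumps at p, then every mean of a point slightly left of p and
a point slightly right of p is p itself, because the average of the two values
falls inside the gap.  Applying (c) to the pairs (p - h, p + 3h) and
(p + 3h, p - h), whose midpoints are both p + h, gives p + h <= p; hence f is
continuous.  Now (c) says that Psi is midpoint concave, and since Psi is
monotone it is bounded on segments; a midpoint convex function that is bounded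
above on a segment is convex there ([midpoint_convex_unit]).

(d) => (e).  Symmetry of Psi and Psi(u,u) = u make f convex.  All the regularity
then comes from one device, [convex_touched_derivable]: a convex function lies
above a supporting line at each point, so if it is touched there from above by a
differentiable function it is differentiable.  A suitable parabola touches f
from above somewhere in any given interval, and the supergradients of Psi(., v)
carry differentiability from one point x to the midpoint of x and g(v), hence to
every point.  A differentiable convex function has a continuous derivative.  The
tangent inequality of Psi now says that
   E(s, x) = (f(s) - f(x)) / f'(x)
is convex in x for each s.  For a < x < b the functions E(a, .) and E(b, .) are
both convex, but they are multiples of 1/f' of opposite signs, so that a
supporting line of one yields a function touching the other from above; hence
1/f' is differentiable.  Continuity of f'' follows because the derivative of the
convex function E(s, .) is continuous.

(d) <=> (e) once f is twice differentiable.  The second derivative of Psi along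
a line is f'(m) (p(m) ((a + b)/2)^2 - (p(x) a^2 + p(y) b^2)/2) with p = f''/f',
m = (x + y)/2 and a, b the velocities of x and y, so that (d) means that (x, a)
|-> p(x) a^2 is midpoint convex.  By [square_midconvexP] this holds exactly
when p vanishes identically, or p > 0 and 1/p is concave.

(d) => (b).  Summing, with weights, the tangent inequality of Psi at the point
given by the two weighted averages of the values of f makes the linear terms
cancel. *)

(** * Midpoint convexity and convexity on an interval *)

Section convex_functions.
Variable R : realType.
Implicit Types (I : set R) (f h k : R -> R).

Lemma unit_onem (t : R) : 0 <= t <= 1 -> 0 <= 1 - t <= 1.
Proof. lra. Qed.

Lemma ler_abs_unit (a t : R) : 0 <= t <= 1 -> - `|a| <= t * a.
Proof.
move=> /andP[t0 t1]; have := ler_norm (- a); have := normr_ge0 a;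
  rewrite normrN.
by nra.
Qed.

(** The excess d over the chord vanishes at the endpoints, and each t is the
midpoint of an endpoint and another point of the segment, so that
d t <= sup d / 2; hence sup d <= sup d / 2. *)
Lemma midpoint_convex_unit k :
  (forall s t, 0 <= s <= 1 -> 0 <= t <= 1 ->
    k ((s + t) / 2) <= (k s + k t) / 2) ->
  (exists M, forall t, 0 <= t <= 1 -> k t <= M) ->
  forall t, 0 <= t <= 1 -> k t <= t * k 1 + (1 - t) * k 0.
Proof.
move=> mid [M kM].
pose d t := k t - (t * k 1 + (1 - t) * k 0).
pose D := [set d t | t in [set t | 0 <= t <= 1]].
have m0 : 0 <= (0 : R) <= 1 by rewrite lexx ler01.
have m1 : 0 <= (1 : R) <= 1 by rewrite ler01 lexx.
have supD : has_sup D.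
  split; first by exists (d 0), 0 => //=.
  exists (M + `|k 0| + `|k 1|) => _ [t t01 <-]; rewrite /d.
  have := kM _ t01; have /andP[t0 t1] := t01.
  have := @ler_abs_unit (k 1) t t01; have /ler_abs_unit := @unit_onem t t01.
  by move=> /(_ (k 0)); lra.
have leS t : 0 <= t <= 1 -> d t <= sup D.
  by move=> t01; apply: ub_le_sup; [case: supD|exists t].
have dmid s t : 0 <= s <= 1 -> 0 <= t <= 1 ->
  d ((s + t) / 2) <= (d s + d t) / 2.
  by move=> s01 t01; have := mid _ _ s01 t01; rewrite /d; lra.
have half t : 0 <= t <= 1 -> d t <= sup D / 2.
  move=> t01; have [th|th] := leP t (2^-1).
    have h : 0 <= 2 * t <= 1 by lra.
    have := dmid 0 (2 * t) m0 h; have := leS _ h.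
    have -> : (0 + 2 * t) / 2 = t by lra.
    have -> : d 0 = 0 by rewrite /d; lra.
    lra.
  have h : 0 <= 2 * t - 1 <= 1 by lra.
  have := dmid 1 (2 * t - 1) m1 h; have := leS _ h.
  have -> : (1 + (2 * t - 1)) / 2 = t by lra.
  have -> : d 1 = 0 by rewrite /d; lra.
  lra.
have S2 : sup D <= sup D / 2.
  by apply: ge_sup; [case: supD|move=> _ [t t01 <-]; exact: half].
by move=> t t01; have := leS _ t01; rewrite /d; lra.
Qed.

Definition convex_on I h := forall x y t, I x -> I y -> 0 <= t <= 1 ->
  h (t * x + (1 - t) * y) <= t * h x + (1 - t) * h y.

Lemma itv_conv I x y t : is_interval I -> I x -> I y -> 0 <= t <= 1 ->
  I (t * x + (1 - t) * y).
Proof.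
move=> itvI Ix Iy t01; have [xy|/ltW yx] := leP x y.
  by apply: (itvI x y Ix Iy); nra.
by apply: (itvI y x Iy Ix); nra.
Qed.

Lemma itv_mid I x y : is_interval I -> I x -> I y -> I ((x + y) / 2).
Proof.
move=> itvI Ix Iy; have -> : (x + y) / 2 = 2^-1 * x + (1 - 2^-1) * y by lra.
by apply: itv_conv => //; lra.
Qed.

Lemma midpoint_convex_on I h : is_interval I ->
  (forall x y, I x -> I y -> h ((x + y) / 2) <= (h x + h y) / 2) ->
  (forall x y, I x -> I y -> exists M, forall z, x <= z <= y -> h z <= M) ->
  convex_on I h.
Proof.
move=> itvI mid bnd x y t Ix Iy t01.
pose k s := h (s * x + (1 - s) * y).
have := @midpoint_convex_unit k _ _ t t01; rewrite /k.
rewrite mul1r mul0r subrr subr0 mul0r mul1r add0r addr0; apply.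
  move=> a b a01 b01.
  have -> : (a + b) / 2 * x + (1 - (a + b) / 2) * y =
    ((a * x + (1 - a) * y) + (b * x + (1 - b) * y)) / 2 by lra.
  by apply: mid; exact: itv_conv.
have [xy|/ltW yx] := leP x y.
  by have [M hM] := bnd _ _ Ix Iy; exists M => s s01; apply: hM; nra.
by have [M hM] := bnd _ _ Iy Ix; exists M => s s01; apply: hM; nra.
Qed.

Lemma convex_on_chord I h x y z : convex_on I h -> I x -> I z ->
  x < y -> y < z -> (h y - h x) * (z - y) <= (h z - h y) * (y - x).
Proof.
move=> ch Ix Iz xy yz; have zx : 0 < z - x by lra.
have t01 : 0 <= (z - y) / (z - x) <= 1.
  by rewrite divr_ge0 ?ler_pdivrMr ?mul1r//=; lra.
have := ch x z _ Ix Iz t01.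
have -> : (z - y) / (z - x) * x + (1 - (z - y) / (z - x)) * z = y.
  by field; rewrite gt_eqF.
have -> : (z - y) / (z - x) * h x + (1 - (z - y) / (z - x)) * h z =
  ((z - y) * h x + (y - x) * h z) / (z - x).
  by field; rewrite gt_eqF.
rewrite ler_pdivlMr//.
lra.
Qed.

End convex_functions.

(** * Supporting lines and differentiability of convex functions *)

Section convex_calculus.
Variable R : realType.
Implicit Types (I : set R) (f h k : R -> R).

Lemma nbhs_itv (x : R) (P : R -> Prop) : (\forall z \near x, P z) ->
  exists2 e, 0 < e & forall z, x - e < z < x + e -> P z.
Proof.
move=> /nbhs_ballP[e /= e0 He]; exists e => // z zx; apply: He.
by rewrite /ball/= ltr_norml; lra.
Qed.

Lemma near_itv (x e : R) : 0 < e -> \forall z \near x, x - e < z < x + e.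
Proof.
move=> e0; near=> z.
have : ball x e z by near: z; exact: nbhsx_ballx.
by rewrite /ball/= ltr_norml; lra.
Unshelve. all: by end_near. Qed.

Lemma open_near I x : open I -> I x -> \forall z \near x, I z.
Proof. by move=> oI Ix; exact: open_nbhs_nbhs. Qed.

Lemma open_sides I x : open I -> I x -> exists2 e, 0 < e &
  forall z, x - e <= z <= x + e -> I z.
Proof.
move=> oI /(open_near oI)/nbhs_itv[e e0 He]; exists (e / 2); first lra.
by move=> z ze; apply: He; lra.
Qed.

(** This form compares a function with its linear part without dividing by the
increment. *)
Lemma is_derive_epsP h (x d : R) : is_derive x 1 h d <->
  forall e, 0 < e -> \forall z \near x,
    `|h z - h x - d * (z - x)| <= e * `|z - x|.
Proof.
split=> [/is_derive1_caratheodory[g [gE gc gx]] e e0|H].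
  have /cvgrPdist_lt/(_ e e0) := gc; apply: filterS => z /=.
  rewrite gx distrC gE -mulrBl normrM => gz.
  by apply: ler_wpM2r => //; exact: ltW.
apply/is_derive1_caratheodory.
exists (fun z => if z == x then d else (h z - h x) / (z - x)); split.
- move=> z; case: eqP => [->|/eqP]; first by rewrite !subrr mulr0.
  by rewrite -subr_eq0 => /divfK->.
- apply/cvgrPdist_le => e e0; have := H e e0; apply: filterS => z /=.
  rewrite eqxx; case: eqP => [_ _|/eqP zx]; first by rewrite subrr normr0 ltW.
  have zx0 : z - x != 0 by rewrite subr_eq0.
  move=> Hz; rewrite distrC; move: Hz.
  have -> : h z - h x - d * (z - x) = ((h z - h x) / (z - x) - d) * (z - x).
    by rewrite mulrBl divfK.
  by rewrite normrM ler_pM2r// normr_gt0.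
- by rewrite eqxx.
Qed.

(** k2 - k1 is nonnegative near x and vanishes at x, which forces its slope
there to be zero. *)
Lemma is_derive_squeeze h k1 k2 (x d1 d2 : R) :
  (\forall z \near x, k1 z <= h z) -> (\forall z \near x, h z <= k2 z) ->
  k1 x = h x -> k2 x = h x ->
  is_derive x 1 k1 d1 -> is_derive x 1 k2 d2 -> d1 = d2 /\ is_derive x 1 h d1.
Proof.
move=> n1 n2 e1 e2 /is_derive_epsP D1 /is_derive_epsP D2.
have d12 : d1 = d2.
  have key e : 0 < e -> `|d1 - d2| <= e.
    move=> e0; have e20 : 0 < e / 2 by lra.
    have : \forall z \near x, [/\ k1 z <= k2 z,
        `|k1 z - k1 x - d1 * (z - x)| <= e / 2 * `|z - x|
      & `|k2 z - k2 x - d2 * (z - x)| <= e / 2 * `|z - x|].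
      near=> z; split; [|by near: z; exact: D1|by near: z; exact: D2].
      by apply: (@le_trans _ _ (h z)); near: z.
    move=> /nbhs_itv[c c0 Hc].
    have [] := Hc (x + c / 2); first lra.
    rewrite e1 e2 !ler_norml (_ : x + c / 2 - x = c / 2); last lra.
    rewrite (gtr0_norm (_ : 0 < c / 2)); last lra.
    move=> a1 a2 a3.
    have [] := Hc (x - c / 2); first lra.
    rewrite e1 e2 !ler_norml (_ : x - c / 2 - x = - (c / 2)); last lra.
    rewrite normrN (gtr0_norm (_ : 0 < c / 2)); last lra.
    move=> b1 b2 b3.
    have c20 : 0 < c / 2 by lra.
    by apply/andP; split; rewrite -(ler_pM2r c20); lra.
  apply/eqP; rewrite -subr_eq0 -normr_eq0 eq_le normr_ge0 andbT.
  by apply/ler_addgt0Pl => e e0; rewrite addr0; exact: key.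
split=> //; apply/is_derive_epsP => e e0; near=> z.
have a1 : k1 z <= h z by near: z.
have a2 : h z <= k2 z by near: z.
have : `|k1 z - k1 x - d1 * (z - x)| <= e * `|z - x| by near: z; exact: D1.
have : `|k2 z - k2 x - d2 * (z - x)| <= e * `|z - x| by near: z; exact: D2.
by rewrite e1 e2 -d12 !ler_norml; lra.
Unshelve. all: by end_near. Qed.

(** The supremum of the slopes of chords ending at x works: it is below every
slope of a chord starting at x. *)
Lemma convex_subgradient I h x : open I -> convex_on I h -> I x ->
  exists c, forall y, I y -> h x + c * (y - x) <= h y.
Proof.
move=> oI ch Ix; have [e e0 He] := open_sides oI Ix.
pose L := [set (h x - h y) / (x - y) | y in [set y | I y /\ y < x]].
have ubL z : I z -> x < z -> ubound L ((h z - h x) / (z - x)).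
  move=> Iz xz _ [y [Iy yx] <-].
  rewrite ler_pdivrMr ?subr_gt0// mulrAC ler_pdivlMr ?subr_gt0//.
  exact: (convex_on_chord ch).
have L0 : L !=set0.
  by exists ((h x - h (x - e)) / (x - (x - e))), (x - e) => //; split;
    [apply: He|]; lra.
have supL : has_sup L.
  by split=> //; exists ((h (x + e) - h x) / (x + e - x)); apply: ubL;
    [apply: He|]; lra.
exists (sup L) => y Iy; have [yx|xy|->] := ltgtP y x.
- have : (h x - h y) / (x - y) <= sup L.
    by apply: ub_le_sup; [case: supL|exists y].
  by rewrite ler_pdivrMr ?subr_gt0//; lra.
- have : sup L <= (h y - h x) / (y - x) by apply: ge_sup => //; exact: ubL.
  by rewrite ler_pdivlMr ?subr_gt0//; lra.
- by lra.
Qed.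

Lemma is_derive_affine (a b c x : R) :
  is_derive x 1 (fun z => a + b * (z - c)) b.
Proof.
apply/is_derive_epsP => e e0; near=> z.
rewrite (_ : _ - _ - _ = 0) ?normr0; last lra.
by apply: mulr_ge0 => //; exact: ltW.
Unshelve. all: by end_near. Qed.

(** A supporting line at x is the lower bound of a squeeze whose upper bound is
k. *)
Lemma convex_touched_derivable I h k x : open I -> convex_on I h -> I x ->
  (\forall z \near x, h z <= k z) -> k x = h x -> derivable k x 1 ->
  derivable h x 1.
Proof.
move=> oI ch Ix hk e /derivableP kD; have [c Hc] := convex_subgradient oI ch Ix.
pose a z := h x + c * (z - x).
have n1 : \forall z \near x, a z <= h z.
  by move: (open_near oI Ix); apply: filterS => z /Hc.
have e1 : a x = h x by rewrite /a subrr mulr0 addr0.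
by have [_ [? _]] := is_derive_squeeze n1 hk e1 e (is_derive_affine _ _ _ _) kD.
Qed.

Lemma convex_tangent I h (x d : R) : open I -> convex_on I h -> I x ->
  is_derive x 1 h d ->
  forall y, I y -> h x + d * (y - x) <= h y.
Proof.
move=> oI ch Ix hD; have [c Hc] := convex_subgradient oI ch Ix.
pose a z := h x + c * (z - x).
have n1 : \forall z \near x, a z <= h z.
  by move: (open_near oI Ix); apply: filterS => z /Hc.
have n2 : \forall z \near x, h z <= h z by near=> z.
have e1 : a x = h x by rewrite /a subrr mulr0 addr0.
have [<- _ //] := is_derive_squeeze n1 n2 e1 erefl (is_derive_affine _ _ _ _)
  hD.
Unshelve. all: by end_near. Qed.

Lemma convex_derive_ndecr I h (dh : R -> R) : open I -> convex_on I h ->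
  (forall x, I x -> is_derive x 1 h (dh x)) ->
  forall x y, I x -> I y -> x <= y -> dh x <= dh y.
Proof.
move=> oI ch hD x y Ix Iy; rewrite le_eqVlt => /predU1P[->//|xy].
have := convex_tangent oI ch Ix (hD _ Ix) Iy.
have := convex_tangent oI ch Iy (hD _ Iy) Ix.
by nra.
Qed.

Lemma is_derive_cont h (x d : R) : is_derive x 1 h d -> {for x, continuous h}.
Proof. by move=> [hD _]; exact/differentiable_continuous/derivable1_diffP. Qed.

(** Near x the derivative at y is bounded above and below by the slopes of the
chords from y to the fixed points x + c and x - c, and these are continuous in
y. *)
Lemma convex_derive_continuous I h (dh : R -> R) : open I -> convex_on I h ->
  (forall x, I x -> is_derive x 1 h (dh x)) ->
  forall x, I x -> {for x, continuous dh}.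
Proof.
move=> oI ch hD x Ix; apply/cvgrPdist_le => e e0.
have e20 : 0 < e / 2 by lra.
have /is_derive_epsP/(_ _ e20)/nbhs_itv[c1 c10 H1] := hD _ Ix.
have [c2 c20 H2] := open_sides oI Ix.
have [c [c0 cc1 cc2]] : exists c, [/\ 0 < c, c < c1 & c <= c2].
  by have [l|l] := leP c1 c2; [exists (c1 / 2)|exists (c2 / 2)]; split; lra.
have ec : 0 < e * c by exact: mulr_gt0.
have hx := is_derive_cont (hD _ Ix).
have [Il Ir] : I (x - c) /\ I (x + c) by split; apply: H2; lra.
have xs (z : R) : (h z - h y - (dh x - e) * (z - y)) @[y --> x] -->
    h z - h x - (dh x - e) * (z - x).
  apply: cvgB; first exact: cvgB (cvg_cst _) hx.
  by apply: cvgMr; apply: cvgB; [exact: cvg_cst|exact: cvg_id].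
have xs' (z : R) : (h z - h y - (dh x + e) * (z - y)) @[y --> x] -->
    h z - h x - (dh x + e) * (z - x).
  apply: cvgB; first exact: cvgB (cvg_cst _) hx.
  by apply: cvgMr; apply: cvgB; [exact: cvg_cst|exact: cvg_id].
have l0 : h (x - c) - h x - (dh x - e) * (x - c - x) < 0.
  have /H1 : x - c1 < x - c < x + c1 by lra.
  rewrite (_ : x - c - x = - c); last lra.
  by rewrite normrN (gtr0_norm c0) ler_norml; lra.
have r0 : h (x + c) - h x - (dh x + e) * (x + c - x) < 0.
  have /H1 : x - c1 < x + c < x + c1 by lra.
  rewrite (_ : x + c - x = c); last lra.
  by rewrite (gtr0_norm c0) ler_norml; lra.
have Nl : \forall y \near x, h (x - c) - h y - (dh x - e) * (x - c - y) < 0.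
  exact: cvgr_lt _ (xs (x - c)) _ l0.
have Nr : \forall y \near x, h (x + c) - h y - (dh x + e) * (x + c - y) < 0.
  exact: cvgr_lt _ (xs' (x + c)) _ r0.
near=> y.
have Iy : I y by near: y; exact: open_near.
have yc : x - c < y < x + c by near: y; exact: near_itv.
have := convex_tangent oI ch Iy (hD _ Iy) Il.
have := convex_tangent oI ch Iy (hD _ Iy) Ir.
have : h (x - c) - h y - (dh x - e) * (x - c - y) < 0 by near: y.
have : h (x + c) - h y - (dh x + e) * (x + c - y) < 0 by near: y.
move=> a1 a2 a3 a4.
have [lp rp] : 0 < y - (x - c) /\ 0 < x + c - y by lra.
have lo : dh x - e < dh y by rewrite -(ltr_pM2r lp); lra.
have up : dh y < dh x + e by rewrite -(ltr_pM2r rp); lra.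
by rewrite ler_norml; lra.
Unshelve. all: by end_near. Qed.

Lemma ndecr_derive_ge0 I h (x d : R) : open I ->
  (forall y z, I y -> I z -> y <= z -> h y <= h z) -> I x ->
  is_derive x 1 h d -> 0 <= d.
Proof.
move=> oI hm Ix /is_derive_epsP hD; apply/ler_addgt0Pl => e e0.
have := hD _ e0 => /nbhs_itv[c1 c10 H1].
have [c2 c20 H2] := open_sides oI Ix.
have [c [c0 cc1 cc2]] : exists c, [/\ 0 < c, c < c1 & c <= c2].
  by have [l|l] := leP c1 c2; [exists (c1 / 2)|exists (c2 / 2)]; split; lra.
have xc : h x <= h (x + c) by apply: hm => //; [apply: H2|]; lra.
have /H1 : x - c1 < x + c < x + c1 by lra.
rewrite (_ : x + c - x = c); last lra.
rewrite (gtr0_norm c0) ler_norml => a.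
by rewrite -(pmulr_lge0 _ c0); lra.
Qed.

Lemma derive2_ge0_convex I h (h1 h2 : R -> R) : is_interval I ->
  (forall x, I x -> is_derive x 1 h (h1 x)) ->
  (forall x, I x -> is_derive x 1 h1 (h2 x)) ->
  (forall x, I x -> 0 <= h2 x) -> convex_on I h.
Proof.
move=> itvI D1 D2 h20.
have cont k k' x y : I x -> I y -> (forall x, I x -> is_derive x 1 k (k' x)) ->
    {within `[x, y], continuous k}.
  move=> Ix Iy kD; apply: derivable_within_continuous => z;
    rewrite in_itv/= => zxy.
  by have [] := kD _ (itvI _ _ Ix Iy _ zxy).
have mvt k k' x y : I x -> I y -> (forall x, I x -> is_derive x 1 k (k' x)) ->
  x < y ->
   exists2 c, I c /\ x < c < y & k y - k x = k' c * (y - x).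
  move=> Ix Iy kD xy; have [||c] := @MVT _ k k' x y xy.
  - by move=> z; rewrite in_itv/= => zxy; apply/kD/(itvI _ _ Ix Iy); lra.
  - exact: (cont k k').
  - by rewrite in_itv/= => cxy E; exists c => //; split=> //;
      apply: (itvI _ _ Ix Iy); lra.
have mono x y : I x -> I y -> x <= y -> h1 x <= h1 y.
  move=> Ix Iy; rewrite le_eqVlt => /predU1P[->//|xy].
  by have [c [Ic _]] := mvt h1 h2 x y Ix Iy D2 xy; have := h20 _ Ic; nra.
have tang x y : I x -> I y -> h x + h1 x * (y - x) <= h y.
  move=> Ix Iy; have [xy|yx|->] := ltgtP x y; last lra.
    have [c [Ic cxy]] := mvt h h1 x y Ix Iy D1 xy.
    by have := mono x c Ix Ic; nra.
  have [c [Ic cxy]] := mvt h h1 y x Iy Ix D1 yx.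
  by have := mono c x Ic Ix; nra.
move=> x y t Ix Iy t01; have Iz := itv_conv itvI Ix Iy t01.
by have := tang _ _ Iz Ix; have := tang _ _ Iz Iy; nra.
Qed.

(** The slope k 1 - k 0 of the whole chord is at most that of every chord from 0
to a point of the unit segment. *)
Lemma concave_slope_at0 k (d : R) :
  (forall t, 0 <= t <= 1 -> t * k 1 + (1 - t) * k 0 <= k t) ->
  is_derive (0 : R) 1 k d -> k 1 - k 0 <= d.
Proof.
move=> ck /is_derive_epsP hD; apply/ler_addgt0Pl => e e0.
have := hD _ e0 => /nbhs_itv[c1 c10 H1].
have [c [c0 cc1 cc2]] : exists c, [/\ 0 < c, c < c1 & c <= 1].
  by have [l|l] := leP c1 1; [exists (c1 / 2)|exists (1 / 2)]; split; lra.
have /H1 : 0 - c1 < c < 0 + c1 by lra.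
rewrite subr0 (gtr0_norm c0) ler_norml => a.
have /ck b : 0 <= c <= 1 by lra.
by rewrite -(ler_pM2l c0); lra.
Qed.

(** Where the difference between a steep enough parabola and h is minimal on
[a, b], a vertical translate of the parabola touches h from above. *)
Lemma convex_derivable_point I h (a b : R) : open I -> convex_on I h ->
  (forall x, I x -> {for x, continuous h}) -> a < b ->
  (forall x, a <= x <= b -> I x) ->
  exists2 x, a < x < b & derivable h x 1.
Proof.
move=> oI ch hc ab Iab; pose m := (a + b) / 2; pose l := (b - a) / 2.
have l0 : 0 < l by rewrite /l; lra.
(* K is so large that q - h is larger at a and b than at m. *)
pose K : R := (`|h m| + `|h a| + `|h b| + 1) / l ^+ 2.
(* The parabola K * (x - m) ^ 2, written as a product of affine functions. *)
pose q (x : R) : R := (0 + K * (x - m)) * (0 + 1 * (x - m)).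
have qD (x : R) :
    is_derive x 1 q ((0 + K * (x - m)) * 1 + (0 + 1 * (x - m)) * K).
  exact: is_deriveM (is_derive_affine 0 K m x) (is_derive_affine 0 1 m x).
have [|x xab xm] := @EVT_min _ (fun x => q x - h x) a b (ltW ab).
  apply: continuous_in_subspaceT => x /set_mem/=; rewrite in_itv/= => xab.
  by apply: cvgB; [exact: is_derive_cont (qD x)|exact: hc (Iab _ xab)].
have qe : q a = K * l ^+ 2 /\ q b = K * l ^+ 2.
  by rewrite /q /l /m; split; field.
have KE : K * l ^+ 2 = `|h m| + `|h a| + `|h b| + 1.
  by rewrite /K divfK// expf_neq0 ?gt_eqF.
have qm : q m = 0 by rewrite /q subrr; ring.
have := ler_norm (h a); have := ler_norm (h b); have := ler_norm (- h m).
have := normr_ge0 (h a); have := normr_ge0 (h b).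
rewrite normrN => h1 h2 h3 h4 h5.
have := xm m; rewrite in_itv/= => /(_ _)-H;
have {}H := H ltac:(rewrite /m; lra).
have xne y : q y = K * l ^+ 2 -> `|h y| <= `|h a| + `|h b| -> x != y.
  move=> qy hy; apply/eqP => xy; move: H; rewrite xy qy qm KE.
  by have := ler_norm (h y); lra.
move: (xab); rewrite in_itv/= !le_eqVlt => /andP[/orP[/eqP ax|ax]].
  by have := xne a qe.1; rewrite ax eqxx => /(_ _)/negP[]//; lra.
move=> /orP[/eqP xb|xb]; first by have := xne b qe.2;
  rewrite xb eqxx => /(_ _)/negP[]//; lra.
exists x; first by rewrite ax.
apply: (@convex_touched_derivable I h (fun z => q z - (q x - h x)) x) => //.
- by apply: Iab; rewrite !ltW.
- have e0 : 0 < Num.min (x - a) (b - x) by rewrite lt_min; lra.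
  have := near_itv x e0; apply: filterS => z; rewrite !(ltrBlDr,ltrBlDl)=> zz.
  have : z \in `[a, b].
    rewrite in_itv/=; have := ge_min (x - a) (x - a) (b - x);
      have := ge_min (b - x) (x - a) (b - x).
    by rewrite !lexx orbT/=; lra.
  by move=> /xm; lra.
- lra.
Qed.

End convex_calculus.

(** * Concavity of Psi makes f convex and differentiable *)

Section pointwise_derivatives.
Variable R : realType.
Implicit Types (p q : R -> R) (x dp dq c : R).

(** The differentiation rules for functions given by an expression in z, the
form in which they can be chained as terms. *)
Lemma is_deriveD_pt p q x dp dq : is_derive x 1 p dp -> is_derive x 1 q dq ->
  is_derive x 1 (fun z => p z + q z) (dp + dq).
Proof. exact: is_deriveD. Qed.

Lemma is_deriveN_pt p x dp : is_derive x 1 p dp ->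
  is_derive x 1 (fun z => - p z) (- dp).
Proof. exact: is_deriveN. Qed.

Lemma is_deriveB_pt p q x dp dq : is_derive x 1 p dp -> is_derive x 1 q dq ->
  is_derive x 1 (fun z => p z - q z) (dp - dq).
Proof. exact: is_deriveB. Qed.

Lemma is_deriveM_pt p q x dp dq : is_derive x 1 p dp -> is_derive x 1 q dq ->
  is_derive x 1 (fun z => p z * q z) (p x * dq + q x * dp).
Proof. exact: is_deriveM. Qed.

Lemma is_derive_cst_pt c x : is_derive x 1 (fun=> c) 0.
Proof. exact: is_derive_cst. Qed.

Lemma is_deriveMr_pt p x dp c : is_derive x 1 p dp ->
  is_derive x 1 (fun z => p z * c) (dp * c).
Proof.
move=> D; have := is_deriveM_pt D (is_derive_cst_pt c x).
by rewrite mulr0 add0r mulrC.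
Qed.

Lemma is_deriveV_pt p x dp : p x != 0 -> is_derive x 1 p dp ->
  is_derive x 1 (fun z => (p z)^-1) (- dp / p x ^+ 2).
Proof.
move=> p0 D; apply: is_derive_eq (is_deriveV p0 D) _.
by rewrite /GRing.scale/= mulNr mulrC mulNr.
Qed.

Lemma is_derive_div_pt p q x dp dq : q x != 0 -> is_derive x 1 p dp ->
  is_derive x 1 q dq ->
  is_derive x 1 (fun z => p z / q z) ((dp * q x - p x * dq) / q x ^+ 2).
Proof.
move=> q0 Dp Dq; apply: is_derive_eq (is_deriveM_pt Dp (is_deriveV_pt q0 Dq)) _.
by field.
Qed.

Lemma is_derive_comp_pt p q x dp dq : is_derive (q x) 1 p dp ->
  is_derive x 1 q dq ->
  is_derive x 1 (fun z => p (q z)) (dp * dq).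
Proof. exact: is_derive1_comp. Qed.

End pointwise_derivatives.

(** Concavity of [Psi] on chords, with an arbitrary left inverse g of f on I in
place of the chosen one. *)
Definition Psi_concave (R : realType) (I : set R) (f g : R -> R) :=
  forall u v u' v' t, (f @` I) u -> (f @` I) v ->
  (f @` I) u' -> (f @` I) v' -> 0 <= t <= 1 ->
  t * f ((g u + g v) / 2) + (1 - t) * f ((g u' + g v') / 2) <=
  f ((g (t * u + (1 - t) * u') + g (t * v + (1 - t) * v')) / 2).

Section strictly_increasing.
Variables (R : realType) (I : set R) (f g : R -> R).
Hypotheses (oI : open I) (itvI : is_interval I).
Hypothesis (f_incr : strictly_increasing_on I f).
Hypothesis (gK : forall x, I x -> g (f x) = x).

Lemma incr_le x y : I x -> I y -> (f x <= f y) = (x <= y).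
Proof.
move=> Ix Iy; have [xy|yx|->] := ltgtP x y; last by rewrite lexx.
  by rewrite ltW// f_incr.
by rewrite leNgt f_incr.
Qed.

Lemma inv_image u : (f @` I) u -> I (g u) /\ f (g u) = u.
Proof. by case=> x Ix <-; rewrite gK. Qed.

Lemma inv_le u v : (f @` I) u -> (f @` I) v -> (g u <= g v) = (u <= v).
Proof. by move=> [x Ix <-] [y Iy <-]; rewrite !gK// incr_le. Qed.

Hypothesis fc : forall x, I x -> {for x, continuous f}.

Lemma image_itv : is_interval (f @` I).
Proof.
move=> _ _ [x Ix <-] [y Iy <-] z /andP[xz zy].
have xy : x <= y by rewrite -incr_le//; exact: le_trans zy.
have [||c] := @IVT _ f x y z xy.
- apply: continuous_in_subspaceT => t /set_mem/=; rewrite in_itv/= => txy.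
  by apply: fc; exact: (itvI Ix Iy).
- by rewrite min_l ?max_r ?incr_le// xz.
- by rewrite in_itv/= => cxy <-; exists c => //; exact: (itvI Ix Iy).
Qed.

Lemma image_open : open (f @` I).
Proof.
rewrite openE => _ [x Ix <-]; have [e e0 He] := open_sides oI Ix.
have [Il Ir] : I (x - e) /\ I (x + e) by split; apply: He; lra.
have l : f (x - e) < f x by apply: f_incr => //; lra.
have r : f x < f (x + e) by apply: f_incr => //; lra.
rewrite /interior; near=> z.
apply: (@image_itv (f (x - e)) (f (x + e)));
  [by exists (x - e)|by exists (x + e)|].
apply/andP; split; apply: ltW; near: z; [exact: lt_nbhsr|exact: lt_nbhsl].
Unshelve. all: by end_near. Qed.

Lemma is_derive_inv u d : (f @` I) u -> is_derive (g u) 1 f d -> d != 0 ->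
  is_derive u 1 g d^-1.
Proof.
move=> /inv_image[Iu fu] D d0; rewrite -fu; apply: is_derive_inverse D d0.
  by near=> z; apply: gK; near: z; exact: open_near.
by near=> z; apply: fc; near: z; exact: open_near.
Unshelve. all: by end_near. Qed.

Hypothesis concPsi : Psi_concave I f g.

(** Psi(u,v) = Psi(v,u), so concavity bounds Psi(u,v) by the value of Psi at the
point of the diagonal halfway between (u,v) and (v,u), which is (u + v)/2. *)
Lemma Psi_concave_convex : convex_on I f.
Proof.
apply: midpoint_convex_on => // [x y Ix Iy|x y Ix Iy]; last first.
  exists (f y) => z xzy; rewrite incr_le//; first by case/andP: xzy.
  exact: (itvI Ix Iy).
have [Jx Jy] : (f @` I) (f x) /\ (f @` I) (f y) by split; [exists x|exists y].
have := @concPsi _ _ _ _ 2^-1 Jx Jy Jy Jx; rewrite !gK//.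
have -> : 2^-1 * f x + (1 - 2^-1) * f y = (f x + f y) / 2 by lra.
have -> : 2^-1 * f y + (1 - 2^-1) * f x = (f x + f y) / 2 by lra.
set w := (f x + f y) / 2 => H.
have [|_ gw] := @inv_image w; first exact: itv_mid image_itv _ _.
move: H; have -> : (g w + g w) / 2 = g w by lra.
by rewrite gw [y + x]addrC => H; have := H ltac:(lra); lra.
Qed.

(** To treat a point p, take a point x of differentiability so close to p that
y = 2p - x is in I.  A supergradient of Psi(., f y) at f x bounds f near
p = (x + y)/2 by a function built from f near x. *)
Lemma Psi_concave_derivable p : I p -> derivable f p 1.
Proof.
move=> Ip; have [e e0 He] := open_sides oI Ip.
have [||x xpe fx] := @convex_derivable_point _ I f (p - e) (p + e) oI
  Psi_concave_convex fc.
- lra.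
- by move=> x xe; apply: He; lra.
have Ix : I x by apply: He; lra.
pose y := 2 * p - x; have Iy : I y by apply: He; rewrite /y; lra.
have [Jx Jy] : (f @` I) (f x) /\ (f @` I) (f y) by split; [exists x|exists y].
have ck : convex_on (f @` I) (fun u => - f ((g u + y) / 2)).
  move=> u v t Ju Jv t01; have := concPsi Ju Jy Jv Jy t01.
  have -> : t * f y + (1 - t) * f y = f y by lra.
  by rewrite gK//; lra.
have [c Hc] := convex_subgradient image_open ck Jx.
have aD : is_derive p 1 (fun z => x + 2 * (z - p)) 2 by exact: is_derive_affine.
have [e1 e10 He1] := open_sides oI Ix.
apply: (@convex_touched_derivable _ I f (fun z =>
  f p - (f (x + 2 * (z - p)) - f x) * c)) => //.
- exact: Psi_concave_convex.
- have e20 : 0 < e1 / 2 by lra.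
  have := near_itv p e20; apply: filterS => z ze.
  have Iz : I (x + 2 * (z - p)) by apply: He1; lra.
  have := Hc (f (x + 2 * (z - p))) _; rewrite !gK//.
  have -> : (x + y) / 2 = p by rewrite /y; lra.
  have -> : (x + 2 * (z - p) + y) / 2 = z by rewrite /y; lra.
  by move=> H; have := H ltac:(by exists (x + 2 * (z - p))); lra.
- by rewrite subrr mulr0 addr0 subrr mul0r subr0.
have fD : is_derive (x + 2 * (p - p)) 1 f ('D_1 f x).
  by rewrite subrr mulr0 addr0; exact/derivableP.
have := is_deriveB_pt (is_derive_cst_pt (f p) p)
  (is_deriveMr_pt c (is_deriveB_pt (@is_derive_comp_pt _ f (fun z =>
    x + 2 * (z - p)) p _ _ fD aD) (is_derive_cst_pt (f x) p))).
by case.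
Qed.

Lemma Psi_concave_derive_gt0 x d : I x -> is_derive x 1 f d -> 0 < d.
Proof.
move=> Ix fD; have [e e0 He] := open_sides oI Ix.
have Ie : I (x - e) by apply: He; lra.
have := convex_tangent oI Psi_concave_convex Ix fD Ie.
have : f (x - e) < f x by apply: f_incr => //; lra.
move=> a b; rewrite -(pmulr_lgt0 _ e0); lra.
Qed.

End strictly_increasing.

(** * Concavity of Psi makes f twice continuously differentiable *)

Section first_derivative.
Variables (R : realType) (I : set R) (f g f1 : R -> R).
Hypotheses (oI : open I) (itvI : is_interval I).
Hypothesis (f_incr : strictly_increasing_on I f).
Hypothesis (gK : forall x, I x -> g (f x) = x).
Hypothesis fD : forall x, I x -> is_derive x 1 f (f1 x).
Hypothesis f1_gt0 : forall x, I x -> 0 < f1 x.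

Let fc x : I x -> {for x, continuous f}.
Proof. by move=> /fD/is_derive_cont. Qed.

Let f1_neq0 x : I x -> f1 x != 0.
Proof. by move=> /f1_gt0/lt0r_neq0. Qed.

Lemma is_derive_inv_path u a t : (f @` I) (u + t * a) ->
  is_derive t 1 (fun s => g (u + s * a)) (a / f1 (g (u + t * a))).
Proof.
move=> J; have [Ig _] := inv_image gK J.
have gD := is_derive_inv oI gK fc J (fD Ig) (f1_neq0 Ig).
have aD : is_derive t 1 (fun s => u + s * a) (0 + 1 * a).
  exact: is_deriveD_pt (is_derive_cst_pt u t)
    (is_deriveMr_pt a (is_derive_id t 1)).
apply: is_derive_eq (@is_derive_comp_pt _ g (fun s => u + s * a) _ _ _ gD aD) _.
by rewrite add0r mul1r mulrC.
Qed.

Lemma is_derive_Psi_path u a v b t :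
  (f @` I) (u + t * a) -> (f @` I) (v + t * b) ->
  is_derive t 1 (fun s => f ((g (u + s * a) + g (v + s * b)) / 2))
    (f1 ((g (u + t * a) + g (v + t * b)) / 2) *
      ((a / f1 (g (u + t * a)) + b / f1 (g (v + t * b))) / 2)).
Proof.
move=> Ju Jv; have [[Ix _] [Iy _]] := (inv_image gK Ju, inv_image gK Jv).
have mD := is_deriveMr_pt 2^-1
  (is_deriveD_pt (is_derive_inv_path Ju) (is_derive_inv_path Jv)).
exact: (@is_derive_comp_pt _ f (fun s => (g (u + s * a) + g (v + s * b)) / 2)
  _ _ _ (fD (itv_mid itvI Ix Iy)) mD).
Qed.

Hypothesis concPsi : Psi_concave I f g.

(** The tangent plane of Psi at (f x, f y), evaluated at (f s, f t). *)
Lemma Psi_concave_tangent x y s t : I x -> I y -> I s -> I t ->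
  f ((s + t) / 2) - f ((x + y) / 2) <= f1 ((x + y) / 2) *
    (((f s - f x) / f1 x + (f t - f y) / f1 y) / 2).
Proof.
move=> Ix Iy Is It.
have J z : I z -> (f @` I) (f z) by move=> Iz; exists z.
pose k r := f ((g (f x + r * (f s - f x)) + g (f y + r * (f t - f y))) / 2).
have k0 : k 0 = f ((x + y) / 2) by rewrite /k !mul0r !addr0 !gK.
have k1 : k 1 = f ((s + t) / 2).
  by rewrite /k !mul1r ![_ + (_ - _)]addrC !subrK !gK.
rewrite -k0 -k1; apply: concave_slope_at0.
  move=> r r01; rewrite k0 k1 /k.
  have := concPsi (J _ Is) (J _ It) (J _ Ix) (J _ Iy) r01; rewrite !gK//.
  have -> : r * f s + (1 - r) * f x = f x + r * (f s - f x) by ring.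
  by have -> : r * f t + (1 - r) * f y = f y + r * (f t - f y) by ring.
have := @is_derive_Psi_path (f x) (f s - f x) (f y) (f t - f y) 0.
by rewrite !mul0r !addr0 !gK//; apply; exact: J.
Qed.

(** With s = t the tangent inequality, divided by f' at the midpoint, is
midpoint convexity; boundedness holds because f and f' are nondecreasing. *)
Lemma Psi_concave_quotient_convex s : I s ->
  convex_on I (fun x => (f s - f x) / f1 x).
Proof.
move=> Is; apply: midpoint_convex_on => // [x y Ix Iy|x y Ix Iy].
  have Im := itv_mid itvI Ix Iy.
  have := Psi_concave_tangent Ix Iy Is Is.
  have -> : (s + s) / 2 = s by lra.
  by move=> H; rewrite ler_pdivrMr ?f1_gt0// [leRHS]mulrC.
exists (`|f s - f x| / f1 x) => z xzy.
have Iz : I z by exact: (itvI Ix Iy).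
have xz : x <= z by case/andP: xzy.
have fcv := Psi_concave_convex itvI f_incr gK fc concPsi.
have f1xz := convex_derive_ndecr oI fcv fD Ix Iz xz.
have fxz : f x <= f z by rewrite (incr_le f_incr).
have f1x := f1_gt0 Ix.
rewrite ler_pdivrMr ?f1_gt0// mulrAC ler_pdivlMr//.
have := ler_norm (f s - f x); have := normr_ge0 (f s - f x).
by nra.
Qed.

(** Writing E s z = (f s - f z) / f1 z, for a < x < b the functions E a and E b
are both convex while E a / E b is negative and differentiable near x.  A
supporting line of E b therefore becomes, after multiplication by E a / E b, a
function that touches E a from above at x. *)
Lemma Psi_concave_derivable2 x : I x -> derivable f1 x 1.
Proof.
move=> Ix; have [e e0 He] := open_sides oI Ix.
have Il : I (x - e) by apply: He; lra.
have Ir : I (x + e) by apply: He; lra.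
set a := x - e in Il; set b := x + e in Ir.
have fab z : a < z < b -> [/\ I z, f a < f z & f z < f b].
  move=> zab; have Iz : I z by apply: (itvI Il Ir); lra.
  by split=> //; apply: f_incr => //; case/andP: zab.
have xab : a < x < b by rewrite /a /b; lra.
pose E s z := (f s - f z) / f1 z.
have [c Hc] := convex_subgradient oI (Psi_concave_quotient_convex Ir) Ix.
have [_ fax fxb] := fab _ xab.
pose k z := (E b x + c * (z - x)) * ((f a - f z) / (f b - f z)).
have fbx0 : f b - f x != 0 by rewrite gt_eqF// subr_gt0.
have cD w : is_derive x 1 (fun z => w - f z) (0 - f1 x).
  exact: is_deriveB_pt (is_derive_cst_pt w x) (fD Ix).
have kD : derivable k x 1.
  have qD := @is_derive_div_pt _ (fun z => f a - f z) (fun z => f b - f z) x _ _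
    fbx0 (cD (f a)) (cD (f b)).
  by case: (is_deriveM_pt (is_derive_affine (E b x) c x x) qD).
have ED : derivable (E a) x 1.
  apply: (convex_touched_derivable oI (Psi_concave_quotient_convex Il) Ix) kD.
  - have := near_itv x e0; apply: filterS => z zab.
    have [Iz faz fzb] := fab z zab; have f1z := f1_gt0 Iz.
    have := Hc _ Iz; rewrite -/(E b x) => H.
    rewrite /k -/(E a z) [E a z](_ :
      _ = (f b - f z) / f1 z * ((f a - f z) / (f b - f z))); last first.
      rewrite /E; field; rewrite f1_neq0// gt_eqF// subr_gt0//.
    apply: ler_wnM2r H; rewrite ler_pdivrMr ?subr_gt0// mul0r; lra.
  - by rewrite /k /E subrr mulr0 addr0; field; rewrite f1_neq0.
have Eax : E a x != 0 by rewrite /E mulf_neq0 ?invr_eq0 ?f1_neq0// lt_eqF//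
  subr_lt0.
have [D _] := @is_derive_div_pt _ (fun z => f a - f z) (E a) x _ _ Eax
  (cD (f a)) (derivableP ED).
apply: near_eq_derivable D.
have := near_itv x e0; apply: filterS => z /fab[Iz faz _].
rewrite /E; field; rewrite f1_neq0//= lt_eqF// subr_lt0//.
Qed.

(** The derivative of the convex function x |-> (f s - f x) / f1 x is
continuous, and f'' can be recovered from it where x differs from s. *)
Lemma Psi_concave_continuous2 x : I x ->
  {for x, continuous (fun z => 'D_1 f1 z)}.
Proof.
move=> Ix; have [e e0 He] := open_sides oI Ix.
have Is : I (x - e) by apply: He; lra.
set s := x - e in Is; set f2 := fun z => 'D_1 f1 z.
pose dE z := ((0 - f1 z) * f1 z - (f s - f z) * f2 z) / f1 z ^+ 2.
have ED z : I z -> is_derive z 1 (fun z => (f s - f z) / f1 z) (dE z).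
  move=> Iz; apply: is_derive_div_pt; first exact: f1_neq0.
    exact: is_deriveB_pt (is_derive_cst_pt (f s) z) (fD Iz).
  by apply/derivableP; exact: Psi_concave_derivable2.
have cE := convex_derive_continuous oI (Psi_concave_quotient_convex Is) ED Ix.
have cf1 : {for x, continuous f1} :=
  is_derive_cont (derivableP (Psi_concave_derivable2 Ix)).
have fsx : f s < f x by apply: f_incr => //; rewrite /s; lra.
have cG : (fun z => - ((dE z + 1) * (f1 z * f1 z)) / (f s - f z)) @ x -->
    - ((dE x + 1) * (f1 x * f1 x)) / (f s - f x).
  apply: cvgM.
    apply: cvgN; apply: cvgM; last exact: cvgM.
    by apply: cvgD => //; exact: cvg_cst.
  apply: cvgV; first by rewrite lt_eqF// subr_lt0.
  by apply: cvgB; [exact: cvg_cst|exact: fc].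
have EG z : I z -> s < z -> - ((dE z + 1) * (f1 z * f1 z)) / (f s - f z) = f2 z.
  move=> Iz sz; have fsz := f_incr Is Iz sz.
  rewrite /dE; field; rewrite f1_neq0//= lt_eqF// subr_lt0//.
change (f2 @ x --> f2 x); rewrite -(EG x)//; last by rewrite /s; lra.
apply: cvg_trans cG; apply: near_eq_cvg; near=> z.
apply: EG; first by near: z; exact: open_near.
near: z; apply: lt_nbhsr; rewrite /s; lra.
Unshelve. all: by end_near. Qed.

End first_derivative.

(** * The second-order condition *)

Section square_perspective.
Variables (R : realType) (I : set R) (p : R -> R).
Hypothesis itvI : is_interval I.

(** Midpoint convexity of (x, a) |-> p x * a ^ 2 on I * R. *)
Definition square_midconvex := forall x y a b, I x -> I y ->
  p ((x + y) / 2) * ((a + b) / 2) ^+ 2 <= (p x * a ^+ 2 + p y * b ^+ 2) / 2.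

Lemma square_midconvex_ge0 x : square_midconvex -> I x -> 0 <= p x.
Proof.
move=> H Ix; have := H x x 1 (- 1) Ix Ix.
by rewrite sqrrN expr1n subrr mul0r expr0n/= mulr0; lra.
Qed.

(** With the second velocity equal to 0, a zero of p at x gives a zero at the
midpoint of x and any other point.  Halving the distance to z again and again
produces zeros converging to z. *)
Lemma square_midconvex_eq0 x z : square_midconvex -> I x -> I z ->
  {for z, continuous p} -> p x = 0 -> p z = 0.
Proof.
move=> H Ix Iz pz px0.
have pn n : I (z + (x - z) / 2 ^+ n) /\ p (z + (x - z) / 2 ^+ n) = 0.
  elim: n => [|n [In pn]]; first by rewrite expr0 divr1 addrC subrK.
  have -> : z + (x - z) / 2 ^+ n.+1 = (z + (x - z) / 2 ^+ n + z) / 2.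
    by rewrite exprS; field; rewrite expf_neq0.
  have Im := itv_mid itvI In Iz; split=> //.
  have := H _ _ 2 0 In Iz; rewrite pn addr0 divff// expr1n expr0n/=.
  by have := square_midconvex_ge0 H Im; lra.
have := square_midconvex_ge0 H Iz; rewrite le_eqVlt => /predU1P[//|pz0].
have /nbhs_itv[e e0 He] : \forall y \near z, 0 < p y by exact: cvgr_gt pz _ pz0.
(* As n < 2 ^ n, this n also bounds the number of halvings needed. *)
pose n := Num.bound (`|x - z| / e).
have nb : `|x - z| / 2 ^+ n < e.
  rewrite ltr_pdivrMr ?exprn_gt0// mulrC -ltr_pdivrMr//.
  have : `|x - z| / e < n%:R by apply: archi_boundP; rewrite divr_ge0// ltW.
  by move=> /lt_trans; apply; rewrite -natrX ltr_nat ltn_expl.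
have [_ pn0] := pn n.
have : `|(x - z) / 2 ^+ n| < e by rewrite normrM (@gtr0_norm _ (2 ^+ n)^-1)//
  invr_gt0 exprn_gt0.
rewrite ltr_norml => nb'.
by have := He (z + (x - z) / 2 ^+ n) ltac:(lra); rewrite pn0 ltxx.
Qed.

(** If p > 0, the velocities 1/p(x) and 1/p(y) turn the inequality into midpoint
concavity of 1/p, which is bounded below by 0.  The converse is the inequality
(a + b)^2 / (u + v) <= a^2 / u + b^2 / v with u = 1/p(x) and v = 1/p(y). *)
Lemma square_midconvexP : (forall x, I x -> {for x, continuous p}) ->
  square_midconvex <->
  (forall x, I x -> p x = 0) \/
  ((forall x, I x -> 0 < p x) /\ convex_on I (fun x => - (p x)^-1)).
Proof.
move=> pc; split=> [H|[p0 x y a b Ix Iy|[p0 cq] x y a b Ix Iy]].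
- have [[x Ix px0]|N] := pselect (exists2 x, I x & p x = 0).
    by left=> z Iz; exact: square_midconvex_eq0 (pc _ Iz) px0.
  have p0 x : I x -> 0 < p x.
    move=> Ix; rewrite lt_neqAle square_midconvex_ge0// andbT eq_sym.
    by apply/eqP => px; apply: N; exists x.
  right; split=> //; apply: midpoint_convex_on => // [x y Ix Iy|x y Ix Iy].
    have px := p0 _ Ix; have py := p0 _ Iy;
      have pm := p0 _ (itv_mid itvI Ix Iy).
    (* These velocities minimise the right-hand side for a given sum. *)
    have := H x y (p x)^-1 (p y)^-1 Ix Iy.
    have -> : p x * (p x)^-1 ^+ 2 = (p x)^-1 by field; rewrite gt_eqF.
    have -> : p y * (p y)^-1 ^+ 2 = (p y)^-1 by field; rewrite gt_eqF.
    set s := _ / 2 => Hs.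
    have s0 : 0 < s by rewrite divr_gt0// addr_gt0 ?invr_gt0.
    have : s <= (p ((x + y) / 2))^-1.
      rewrite -[_^-1]mul1r ler_pdivlMr// mulrC.
      by rewrite -(ler_pM2r s0) -mulrA mul1r -expr2.
    by rewrite /s; lra.
  exists 0 => z xzy; have /p0 := itvI Ix Iy xzy.
  by rewrite -invr_gt0; lra.
- by rewrite !p0//; [rewrite !mul0r; lra|exact: itv_mid].
- have px := p0 _ Ix; have py := p0 _ Iy; have pm := p0 _ (itv_mid itvI Ix Iy).
  have := cq x y 2^-1 Ix Iy ltac:(lra).
  have -> : 2^-1 * x + (1 - 2^-1) * y = (x + y) / 2 by lra.
  move: px py pm; rewrite -!(@invr_gt0 _ (p _)).
  rewrite -[p x in X in _ -> _ -> _ -> _ -> X]invrK -[p y in X in _ -> _ -> _ ->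
    _ -> X]invrK -[p (_ / _) in X in _ -> _ -> _ -> _ -> X]invrK.
  move: (p x)^-1 (p y)^-1 (p _)^-1 => u v w u0 v0 w0 uvw.
  have uv : (u + v) / 2 <= w by lra.
  rewrite mulrC ler_pdivrMr//.
  apply: (@le_trans _ _ ((u^-1 * a ^+ 2 + v^-1 * b ^+ 2) / 2 * ((u + v) / 2))).
    rewrite -subr_ge0.
    have -> : (u^-1 * a ^+ 2 + v^-1 * b ^+ 2) / 2 * ((u + v) / 2) -
        ((a + b) / 2) ^+ 2 = (v * a - u * b) ^+ 2 / (4 * u * v).
      by field; rewrite !gt_eqF.
    by rewrite divr_ge0 ?sqr_ge0// !mulr_ge0// ltW.
  apply: ler_wpM2l uv; rewrite divr_ge0// addr_ge0// mulr_ge0 ?sqr_ge0//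
    invr_ge0 ltW//.
Qed.

End square_perspective.

Section second_derivative.
Variables (R : realType) (I : set R) (f g f1 f2 : R -> R).
Hypotheses (oI : open I) (itvI : is_interval I).
Hypothesis (f_incr : strictly_increasing_on I f).
Hypothesis (gK : forall x, I x -> g (f x) = x).
Hypothesis fD : forall x, I x -> is_derive x 1 f (f1 x).
Hypothesis f1D : forall x, I x -> is_derive x 1 f1 (f2 x).
Hypothesis f1_gt0 : forall x, I x -> 0 < f1 x.

Let fc x : I x -> {for x, continuous f}.
Proof. by move=> /fD/is_derive_cont. Qed.

Let f1_neq0 x : I x -> f1 x != 0.
Proof. by move=> /f1_gt0/lt0r_neq0. Qed.

Let p x := f2 x / f1 x.

(** The points x and y move with velocities xi and eta, and xi itself has
derivative - p x * xi ^ 2. *)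
Lemma is_derive_Psi_path2 u a v b t (x := g (u + t * a)) (y := g (v + t * b))
    (xi := a / f1 x) (eta := b / f1 y) :
  (f @` I) (u + t * a) -> (f @` I) (v + t * b) ->
  is_derive t 1 (fun s => f1 ((g (u + s * a) + g (v + s * b)) / 2) *
      ((a / f1 (g (u + s * a)) + b / f1 (g (v + s * b))) / 2))
    (f1 ((x + y) / 2) * (p ((x + y) / 2) * ((xi + eta) / 2) ^+ 2 -
      (p x * xi ^+ 2 + p y * eta ^+ 2) / 2)).
Proof.
move=> Ju Jv; have [[Ix _] [Iy _]] := (inv_image gK Ju, inv_image gK Jv).
have Im := itv_mid itvI Ix Iy.
have xD := is_derive_inv_path oI gK fD f1_gt0 Ju.
have yD := is_derive_inv_path oI gK fD f1_gt0 Jv.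
have mD := is_deriveMr_pt 2^-1 (is_deriveD_pt xD yD).
have f1mD := @is_derive_comp_pt _ f1 (fun s =>
  (g (u + s * a) + g (v + s * b)) / 2)
  _ _ _ (f1D Im) mD.
have f1xD := @is_derive_comp_pt _ f1 (fun s => g (u + s * a)) _ _ _ (f1D Ix) xD.
have f1yD := @is_derive_comp_pt _ f1 (fun s => g (v + s * b)) _ _ _ (f1D Iy) yD.
have qx := @is_derive_div_pt _ (fun=> a) (fun s => f1 (g (u + s * a))) _ _ _
  (f1_neq0 Ix) (is_derive_cst_pt a t) f1xD.
have qy := @is_derive_div_pt _ (fun=> b) (fun s => f1 (g (v + s * b))) _ _ _
  (f1_neq0 Iy) (is_derive_cst_pt b t) f1yD.
apply: is_derive_eq (is_deriveM_pt f1mD (is_deriveMr_pt 2^-1 (is_deriveD_pt qx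
  qy))) _.
rewrite -/x -/y in Ix Iy Im *; rewrite /xi /eta /p.
by field; rewrite !f1_neq0.
Qed.

Let dom u a v b := [set t : R | (f @` I) (u + t * a) /\ (f @` I) (v + t * b)].

Let dom_open u a v b : open (dom u a v b).
Proof.
have oJ := image_open oI itvI f_incr fc.
apply: openI.
  by apply: (@open_comp _ _ (fun t : R => u + t * a)) => // t _;
    apply: is_derive_cont;
    exact: is_deriveD_pt (is_derive_cst_pt u t)
      (is_deriveMr_pt a (is_derive_id t 1)).
by apply: (@open_comp _ _ (fun t : R => v + t * b)) => // t _;
  apply: is_derive_cont;
    exact: is_deriveD_pt (is_derive_cst_pt v t)
      (is_deriveMr_pt b (is_derive_id t 1)).
Qed.

Let J_affine u a s t r : (f @` I) (u + s * a) -> (f @` I) (u + t * a) ->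
  s <= r <= t -> (f @` I) (u + r * a).
Proof.
have iJ := image_itv itvI f_incr fc.
move=> Js Jt /andP[sr rt]; have [a0|a0] := leP 0 a.
  by apply: (iJ _ _ Js Jt); rewrite !lerD2l !ler_wpM2r.
by apply: (iJ _ _ Jt Js); rewrite !lerD2l !ler_nM2r// sr rt.
Qed.

Let dom_itv u a v b : is_interval (dom u a v b).
Proof.
move=> s t [us vs] [ut vt] r srt; split.
  exact: J_affine us ut srt.
exact: J_affine vs vt srt.
Qed.

Let phi u a v b (s : R) := f ((g (u + s * a) + g (v + s * b)) / 2).
Let phi1 u a v b (s : R) := f1 ((g (u + s * a) + g (v + s * b)) / 2) *
      ((a / f1 (g (u + s * a)) + b / f1 (g (v + s * b))) / 2).

(** Along each line the second derivative of Psi is f' > 0 times the difference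
of the two sides of [square_midconvex], and every pair of velocities is
realised by a suitable direction. *)
Lemma Psi_concave_square_midconvexP :
  Psi_concave I f g
  <-> square_midconvex I p.
Proof.
split=> [concPsi x y xi eta Ix Iy|K u v u' v' t Ju Jv Ju' Jv' t01].
(* The direction along which x and y have velocities xi and eta. *)
- pose a := xi * f1 x; pose b := eta * f1 y.
  have D0 : dom (f x) a (f y) b 0.
    by split; rewrite mul0r addr0; [exists x|exists y].
  have cphi : convex_on (dom (f x) a (f y) b) (fun s =>
    - phi (f x) a (f y) b s).
    move=> s t r [sx sy] [tx ty] r01; rewrite /phi.
    have := concPsi _ _ _ _ _ sx sy tx ty r01.
    have E w c : r * (w + s * c) + (1 - r) * (w + t * c) = w + (r * s + (1 - r)
      * t) * c.
      by ring.
    by rewrite !E; lra.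
  have phiD t : dom (f x) a (f y) b t ->
      is_derive t 1 (fun s => - phi (f x) a (f y) b s) (- phi1 (f x) a (f y) b
        t).
    by move=> [tx ty]; apply: is_deriveN_pt; exact: is_derive_Psi_path.
  have mono := convex_derive_ndecr (@dom_open _ _ _ _) cphi phiD.
  have := is_deriveN_pt (is_derive_Psi_path2 D0.1 D0.2).
  move=> /(ndecr_derive_ge0 (@dom_open _ _ _ _) mono D0).
  rewrite !mul0r !addr0 !gK// /a /b !mulfK ?f1_neq0//.
  by rewrite -mulrN pmulr_rge0 ?f1_gt0//; [lra|exact: itv_mid].
- pose a := u - u'; pose b := v - v'.
  have D0 : dom u' a v' b 0 by rewrite /dom/= !mul0r !addr0.
  have D1 : dom u' a v' b 1 by rewrite /dom/= !mul1r /a /b ![_ + (_ - _)]addrC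
    !subrK.
  have cphi : convex_on (dom u' a v' b) (fun s => - phi u' a v' b s).
    apply: (derive2_ge0_convex (@dom_itv _ _ _ _)) =>
      [s [su sv]|s [su sv]|s [su sv]].
    + by apply: is_deriveN_pt; exact: is_derive_Psi_path.
    + by apply: is_deriveN_pt; exact: is_derive_Psi_path2.
    + have [[Ix _] [Iy _]] := (inv_image gK su, inv_image gK sv).
      rewrite -mulrN; apply: mulr_ge0; first by apply/ltW/f1_gt0;
        exact: itv_mid.
      by rewrite oppr_ge0 subr_le0; exact: K.
  have := cphi 1 0 t D1 D0 t01; rewrite mulr1 mulr0 addr0 /phi !mul0r !mul1r
    !addr0.
  have E w w' : w + (w' - w) = w' :> R by rewrite addrC subrK.
  rewrite !E.
  have F w w' : t * w + (1 - t) * w' = w' + t * (w - w') by ring.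
  by rewrite !F /a /b; lra.
Qed.

End second_derivative.

(** * The means, and the two-variable inequality *)

Section concave_on_reformulation.
Variable R : realType.
Implicit Types (I : set R) (f h : R -> R).

Lemma concave_onP I h : is_interval I ->
  @concave_on R R^o I h <-> convex_on I (fun x => - h x).
Proof.
move=> itvI; split=> [[_ ch] x y t Ix Iy /andP[t0 t1]|ch].
  exact: (ch (Itv01 t0 t1) x y (mem_set Ix) (mem_set Iy)).
split=> [x y t /set_mem Ix /set_mem Iy|t x y /set_mem Ix /set_mem Iy].
  by apply/mem_set/(itv_conv itvI Ix Iy); rewrite ge0 le1.
by apply: ch => //; rewrite ge0 le1.
Qed.

Lemma concave_on_PsiP I f : is_interval (f @` I) ->
  @concave_on R (R^o * R^o)%type ((f @` I) `*` (f @` I)) (Psi I f) <->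
  Psi_concave I f ('pinv_(fun=> 0) I f).
Proof.
move=> itvJ; split=> [[_ cP] u v u' v' t Ju Jv Ju' Jv' /andP[t0 t1]|cP].
  have := cP (Itv01 t0 t1) (u, v) (u', v') (mem_set (conj Ju Jv)) (mem_set (conj
    Ju' Jv')).
  by move=> H; rewrite -lerN2; apply: le_trans H _; rewrite opprD -!mulrN.
split=> [[u v] [u' v'] t /set_mem[Ju Jv] /set_mem[Ju' Jv']|t [u v] [u' v']
  /set_mem[Ju Jv] /set_mem[Ju' Jv']].
  have t01 : (0 : R) <= t%:num <= 1 by rewrite ge0 le1.
  apply/mem_set; split; first exact: (itv_conv itvJ Ju Ju' t01).
  exact: (itv_conv itvJ Jv Jv' t01).
rewrite lerNl; apply: le_trans (cP u v u' v' t%:num Ju Jv Ju' Jv' _);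
  last by rewrite ge0 le1.
rewrite le_eqVlt; apply/orP; left; apply/eqP.
change (- (t%:num * - Psi I f (u, v) + (1 - t%:num) * - Psi I f (u', v')) =
  t%:num * Psi I f (u, v) + (1 - t%:num) * Psi I f (u', v')).
by ring.
Qed.

End concave_on_reformulation.

Section means.
Variables (R : realType) (I : set R) (f : R -> R).
Hypotheses (oI : open I) (itvI : is_interval I).
Hypothesis (f_incr : strictly_increasing_on I f).

Let G := gen_inv I f.

Lemma gen_invK x : I x -> G (f x) = x.
Proof. by have [_ _] := gen_inv_spec itvI f_incr; exact. Qed.

Lemma qa_mean2 (x : 'I_2 -> R) :
  qa_mean I f x = G ((f (x ord0) + f (x ord_max)) / 2).
Proof.
rewrite /qa_mean big_ord_recr/= big_ord_recr/= big_ord0 add0r;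
  congr (G ((f (x _) + f (x _)) / 2)); exact: val_inj.
Qed.

Lemma weighted_qa_mean1 n (x : 'I_n -> R) :
  weighted_qa_mean I f x (fun=> 1) = qa_mean I f x.
Proof.
rewrite /weighted_qa_mean /qa_mean; congr (gen_inv I f (_ / _)).
  by apply: eq_bigr => i _; rewrite mul1r.
by rewrite sumr_const card_ord.
Qed.

Definition two_point_convex := forall x1 x2 y1 y2, I x1 -> I x2 -> I y1 ->
  I y2 ->
  G ((f ((x1 + y1) / 2) + f ((x2 + y2) / 2)) / 2) <=
  (G ((f x1 + f x2) / 2) + G ((f y1 + f y2) / 2)) / 2.

Lemma two_point_convexP : two_point_convex <->
  forall x y : 'I_2 -> R,
      (forall i, I (x i)) -> (forall i, I (y i)) ->
      qa_mean I f (fun i => (x i + y i) / 2)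
        <= 2^-1 * (qa_mean I f x + qa_mean I f y).
Proof.
split=> [H x y Ix Iy|H x1 x2 y1 y2 Ix1 Ix2 Iy1 Iy2].
  by rewrite !qa_mean2 [leRHS]mulrC; exact: H.
have := H (fun i => if i == ord0 then x1 else x2) (fun i =>
  if i == ord0 then y1 else y2).
by rewrite !qa_mean2/= => h; rewrite [leRHS]mulrC; apply: h => i; case: ifP.
Qed.

(** If all increments across p were at least e, the averages of values taken
slightly to the left and slightly to the right of p would lie between the two
one-sided limits, where the generalized inverse is constantly p. *)
Lemma two_point_convex_gap p e : two_point_convex -> I p -> 0 < e ->
  exists2 x : R * R, [/\ I x.1, I x.2 & x.1 < p < x.2] & f x.2 - f x.1 < e.
Proof.
move=> H Ip e0; apply: contrapT => N.
have gap x1 x2 : I x1 -> I x2 -> x1 < p -> p < x2 -> f x1 + e <= f x2.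
  move=> I1 I2 x1p px2; rewrite leNgt; apply/negP => lt; apply: N.
  by exists (x1, x2); rewrite /= ?x1p ?px2 //; lra.
have [d d0 Hd] := open_sides oI Ip.
have [Il Ir] : I (p - d) /\ I (p + d) by split; apply: Hd; lra.
have [pl pr] : p - d < p /\ p < p + d by lra.
pose L := [set f x | x in [set x | I x /\ x < p]].
pose U := [set f x | x in [set x | I x /\ p < x]].
have supL : has_sup L.
  split; first by exists (f (p - d)), (p - d).
  exists (f (p + d)) => _ [x [Ix xp] <-].
  by have := gap _ _ Ix Ir xp pr; lra.
have infU : has_inf U.
  split; first by exists (f (p + d)), (p + d).
  exists (f (p - d)) => _ [x [Ix xp] <-].
  by have := gap _ _ Il Ix pl xp; lra.
have LU : sup L + e <= inf U.
  apply: lb_le_inf; first by case: infU.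
  move=> _ [x2 [I2 px2] <-]; rewrite -lerBrDr; apply: ge_sup;
    first by case: supL.
  by move=> _ [x1 [I1 x1p] <-]; have := gap _ _ I1 I2 x1p px2; lra.
have leL x : I x -> x < p -> f x <= sup L.
  by move=> Ix xp; apply: ub_le_sup; [case: supL|exists x].
have leU x : I x -> p < x -> inf U <= f x.
  by move=> Ix xp; apply: ge_inf; [case: infU|exists x].
have e20 : 0 < e / 2 by lra.
have [_ [a [Ia ap] <-] La] := sup_adherent e20 supL.
have [_ [b [Ib pb] <-] Ub] := inf_adherent e20 infU.
have [GI Gm GK] := gen_inv_spec itvI f_incr.
have Hf x : I x -> conv_hull (f @` I) (f x) by move=> Ix;
  exact: conv_hull_image.
have Hmid u v : conv_hull (f @` I) u -> conv_hull (f @` I) v ->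
    conv_hull (f @` I) ((u + v) / 2).
  move=> Hu Hv X [/= cX sX]; have h01 : (0 : R) <= 2^-1 by lra.
  have h1 : (2^-1 : R) <= 1 by lra.
  have := cX u v (Itv01 h01 h1) (mem_set (Hu X (conj cX sX))) (mem_set (Hv X
    (conj cX sX))).
  move=> /set_mem.
  have -> : (u + v) / 2 = 2^-1 * u + (1 - 2^-1) * v by lra.
  exact.
have Gp x1 x2 : a <= x1 -> x1 < p -> p < x2 -> x2 <= b ->
  G ((f x1 + f x2) / 2) = p.
  move=> ax1 x1p px2 x2b.
  have I1 : I x1 by apply: (itvI Ia Ip); lra.
  have I2 : I x2 by apply: (itvI Ip Ib); lra.
  have f1l : f a <= f x1 by rewrite (incr_le f_incr).
  have f2u : f x2 <= f b by rewrite (incr_le f_incr).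
  have l1 := leL _ I1 x1p; have u2 := leU _ I2 px2.
  have Cm := Hmid _ _ (Hf _ I1) (Hf _ I2).
  have IG := GI _ Cm.
  set m := (f x1 + f x2) / 2 in Cm IG *.
  have mL : sup L <= m by rewrite /m; lra.
  have mU : m <= inf U by rewrite /m; lra.
  have [Gl|Gr|//] := ltgtP (G m) p.
    pose z := (G m + p) / 2; have Iz : I z by exact: itv_mid.
    have zp : z < p by rewrite /z; lra.
    have := Gm _ _ (Hf _ Iz) Cm (le_trans (leL _ Iz zp) mL).
    by rewrite GK// -/G /z; lra.
  pose z := (G m + p) / 2; have Iz : I z by exact: itv_mid.
  have zp : p < z by rewrite /z; lra.
  have := Gm _ _ Cm (Hf _ Iz) (le_trans mU (leU _ Iz zp)).
  by rewrite GK// -/G /z; lra.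
have [h [h0 ha hb]] : exists h, [/\ 0 < h, h <= p - a & 3 * h <= b - p].
  have [l|l] := leP (p - a) ((b - p) / 3);
    [exists (p - a)|exists ((b - p) / 3)]; split; lra.
have I1 : I (p - h) by apply: (itvI Ia Ip); lra.
have I2 : I (p + 3 * h) by apply: (itvI Ip Ib); lra.
have I3 : I (p + h) by apply: (itvI Ip Ib); lra.
(* Both means on the right equal p although both midpoints are p + h. *)
have := H (p - h) (p + 3 * h) (p + 3 * h) (p - h) I1 I2 I2 I1.
rewrite [f (p + 3 * h) + _]addrC (Gp (p - h) (p + 3 * h)); try lra.
have -> : (p - h + (p + 3 * h)) / 2 = p + h by lra.
have -> : (p + 3 * h + (p - h)) / 2 = p + h by lra.
have -> : (f (p + h) + f (p + h)) / 2 = f (p + h) by lra.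
by rewrite gen_invK//; lra.
Qed.

Lemma two_point_convex_continuous p : two_point_convex -> I p ->
  {for p, continuous f}.
Proof.
move=> H Ip; apply/cvgrPdist_le => e e0.
have [[x1 x2] /= [I1 I2 /andP[x1p px2]] fe] := two_point_convex_gap H Ip e0.
have f1p := f_incr I1 Ip x1p; have fp2 := f_incr Ip I2 px2.
near=> z.
have zx1 : x1 < z by near: z; exact: lt_nbhsr.
have zx2 : z < x2 by near: z; exact: lt_nbhsl.
have Iz : I z by apply: (itvI I1 I2); lra.
have f1z := f_incr I1 Iz zx1; have fz2 := f_incr Iz I2 zx2.
by rewrite ler_norml; lra.
Unshelve. all: by end_near. Qed.

(** Applying f to the two-variable inequality at inverse images gives midpoint
concavity of Psi; monotonicity of f and g gives the lower bound on segments. *)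
Lemma two_point_convex_Psi (g : R -> R) : (forall x, I x -> g (f x) = x) ->
  two_point_convex -> Psi_concave I f g.
Proof.
move=> gK H; have fc x : I x -> {for x, continuous f}.
  by move=> Ix; exact: two_point_convex_continuous.
have itvJ := image_itv itvI f_incr fc.
have gI u : (f @` I) u -> I (g u) by move=> /(inv_image gK)[].
have fg u : (f @` I) u -> f (g u) = u by move=> /(inv_image gK)[].
have GE u : (f @` I) u -> G u = g u by move=> [x Ix <-]; rewrite gK// gen_invK.
have J x : I x -> (f @` I) (f x) by move=> Ix; exists x.
have mid a b a' b' : (f @` I) a -> (f @` I) b -> (f @` I) a' -> (f @` I) b' ->
    (f ((g a + g b) / 2) + f ((g a' + g b') / 2)) / 2 <=
    f ((g ((a + a') / 2) + g ((b + b') / 2)) / 2).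
  move=> Ja Jb Ja' Jb'.
  have Jm : (f @` I) ((f ((g a + g b) / 2) + f ((g a' + g b') / 2)) / 2).
    by apply: itv_mid => //; apply: J; apply: itv_mid => //; exact: gI.
  have Jma := itv_mid itvJ Ja Ja'; have Jmb := itv_mid itvJ Jb Jb'.
  have := H _ _ _ _ (gI _ Ja) (gI _ Ja') (gI _ Jb) (gI _ Jb').
  rewrite !fg// !GE//; rewrite -[X in _ -> X <= _]fg// => le.
  by rewrite (incr_le f_incr)//; [exact: gI|apply: itv_mid => //; exact: gI].
move=> u v u' v' t Ju Jv Ju' Jv' t01.
have Jc a a' s : (f @` I) a -> (f @` I) a' -> 0 <= s <= 1 ->
  (f @` I) (s * a + (1 - s) * a') by move=> *; exact: itv_conv.
pose k s := - f ((g (s * u + (1 - s) * u') + g (s * v + (1 - s) * v')) / 2).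
have := @midpoint_convex_unit R k _ _ t t01.
rewrite /k !mul1r !mul0r subr0 subrr !mul0r !mul1r !addr0 !add0r => M.
suff : - f ((g (t * u + (1 - t) * u') + g (t * v + (1 - t) * v')) / 2) <=
  t * - f ((g u + g v) / 2) + (1 - t) * - f ((g u' + g v') / 2) by lra.
apply: M => [r s r01 s01|].
  have E w w' : (r + s) / 2 * w + (1 - (r + s) / 2) * w' =
    ((r * w + (1 - r) * w') + (s * w + (1 - s) * w')) / 2 by field.
  rewrite !E; have := mid (r * u + (1 - r) * u') (r * v + (1 - r) * v')
   (s * u + (1 - s) * u') (s * v + (1 - s) * v').
  by move=> /(_ (Jc _ _ _ Ju Ju' r01) (Jc _ _ _ Jv Jv' r01)
    (Jc _ _ _ Ju Ju' s01) (Jc _ _ _ Jv Jv' s01)); lra.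
have lower a a' : (f @` I) a -> (f @` I) a' -> exists2 m, (f @` I) m &
    forall s, 0 <= s <= 1 -> m <= s * a + (1 - s) * a'.
  move=> Ja Ja'; have [aa|aa] := leP a a'; [exists a|exists a'] => // s s01;
    nra.
have [mu Jmu Hu] := lower _ _ Ju Ju'; have [mv Jmv Hv] := lower _ _ Jv Jv'.
(* mu and mv are the smaller endpoints of the two segments. *)
exists (- f ((g mu + g mv) / 2)) => s s01; rewrite lerN2 (incr_le f_incr).
- have : g mu <= g (s * u + (1 - s) * u').
    by rewrite (inv_le f_incr gK)//; [exact: Hu|exact: Jc].
  have : g mv <= g (s * v + (1 - s) * v').
    by rewrite (inv_le f_incr gK)//; [exact: Hv|exact: Jc].
  lra.
- by apply: itv_mid => //; exact: gI.
- by apply: itv_mid => //; apply: gI; exact: Jc.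
Qed.

Lemma weighted_mean_in (J : set R) n (u l : 'I_n -> R) : is_interval J ->
  (forall i, J (u i)) -> weights l -> 0 < \sum_(i < n) l i /\
  J ((\sum_(i < n) l i * u i) / \sum_(i < n) l i).
Proof.
move=> itvJ Ju [l0 [i0 li0]].
have S0 : 0 < \sum_(i < n) l i.
  rewrite (bigD1 i0)//= ltr_wpDr ?sumr_ge0//.
  by rewrite lt_neqAle eq_sym li0 l0.
split=> //.
case: (@Order.TotalTheory.arg_minP _ _ _ i0 xpredT u erefl) => a _ ua.
case: (@Order.TotalTheory.arg_maxP _ _ _ i0 xpredT u erefl) => b _ ub.
apply: (itvJ _ _ (Ju a) (Ju b)); rewrite ler_pdivlMr// ler_pdivrMr//.
rewrite !mulr_sumr; apply/andP; split; apply: ler_sum => i _.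
  by rewrite mulrC ler_wpM2l//; exact: ua.
by rewrite [leRHS]mulrC ler_wpM2l//; exact: ub.
Qed.

End means.

(** * The equivalences *)

Section equivalences.
Variables (R : realType) (I : set R) (f : R -> R).
Hypotheses (oI : open I) (itvI : is_interval I).
Hypothesis (f_incr : strictly_increasing_on I f).

Let g := 'pinv_(fun=> 0) I f.

Lemma pinv_incrK x : I x -> g (f x) = x.
Proof.
move=> Ix; apply: pinvKV; last exact/mem_set.
move=> y z /set_mem Iy /set_mem Iz yz.
by apply/eqP; rewrite eq_le -(incr_le f_incr Iy Iz) -(incr_le f_incr Iz Iy) yz
  lexx.
Qed.

(** Derivatives f1 and f2 that matter on I only separate the analytic content
from the conventions for iterated derivatives of total functions. *)
Lemma twice_differentiable_condP :
  (continuously_differentiable_on 2 I f /\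
    (forall x, I x -> 0 < derive1 f x) /\
    ((forall x, I x -> derive1n 2 f x = 0) \/
     (forall x, I x -> 0 < derive1n 2 f x) /\
     @concave_on R R^o I (fun x => derive1 f x / derive1n 2 f x)))
  <->
  exists f1 f2 : R -> R, [/\ forall x, I x -> is_derive x 1 f (f1 x),
    forall x, I x -> is_derive x 1 f1 (f2 x),
    forall x, I x -> {for x, continuous f2},
    forall x, I x -> 0 < f1 x
    & square_midconvex I (fun x => f2 x / f1 x)].
Proof.
have pcont (f1 f2 : R -> R) x : I x -> (forall x, I x -> 0 < f1 x) ->
    (forall x, I x -> is_derive x 1 f1 (f2 x)) ->
    {for x, continuous f2} -> {for x, continuous (fun x => f2 x / f1 x)}.
  move=> Ix f10 f1D f2c; apply: cvgM => //.
  by apply: cvgV; [rewrite gt_eqF ?f10|exact: is_derive_cont (f1D _ Ix)].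
split=> [[[der2 cont2] [f1_gt0 alt]]|[f1 [f2 [fD f1D f2c f1_gt0 K]]]].
  rewrite derive1nS derive1n1 in cont2 alt *.
  have f2c x : I x -> {for x, continuous (derive1 (derive1 f))}.
    by move: cont2; rewrite continuous_open_subspace// => H Ix; exact/H/mem_set.
  have fD x : I x -> is_derive x 1 f (derive1 f x).
    by move=> Ix; rewrite derive1E; apply/derivableP/(der2 0%N).
  have f1D x : I x -> is_derive x 1 (derive1 f) (derive1 (derive1 f) x).
    move=> Ix; rewrite [derive1 (derive1 f) x]derive1E; apply/derivableP.
    by have := der2 1%N isT _ Ix; rewrite derive1n1.
  exists (derive1 f), (derive1 (derive1 f)); split=> //.
  apply/square_midconvexP => //; first by move=> x Ix;
    exact: (pcont _ _ _ Ix f1_gt0 f1D (f2c _ Ix)).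
  case: alt => [f20|[f2_gt0 /(concave_onP _ itvI) cq]].
    by left=> x Ix; rewrite f20// mul0r.
  right; split=> [x Ix|x y t Ix Iy t01];
    first by rewrite divr_gt0// ?f2_gt0// f1_gt0.
  by rewrite !invf_div; exact: cq.
have E1 x : I x -> derive1 f x = f1 x by move=> /fD[_ <-]; rewrite derive1E.
have near1 x : I x -> \forall z \near x, f1 z = derive1 f z.
  by move=> Ix; have := open_near oI Ix; apply: filterS => z /E1.
have D2 x : I x -> is_derive x 1 (derive1 f) (f2 x).
  by move=> Ix; exact: near_eq_is_derive (near1 _ Ix) (f1D _ Ix).
have E2 x : I x -> derive1n 2 f x = f2 x.
  by move=> /D2[_ <-]; rewrite derive1nS derive1n1 derive1E.
split; [split|split].
- case=> [|[|//]] _ x Ix; first by have [] := fD _ Ix.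
  by rewrite derive1n1; have [] := D2 _ Ix.
- rewrite continuous_open_subspace// => x /set_mem Ix.
  change (derive1n 2 f @ x --> derive1n 2 f x); rewrite E2//.
  apply: cvg_trans (f2c _ Ix); apply: near_eq_cvg.
  by have := open_near oI Ix; apply: filterS => z /E2.
- by move=> x Ix; rewrite E1// f1_gt0.
have := (square_midconvexP itvI (fun x Ix =>
  pcont _ _ _ Ix f1_gt0 f1D (f2c _ Ix))).1 K.
case=> [p0|[p0 cq]]; [left=> x Ix|right; split=> [x Ix|]].
- apply/eqP; have /eqP := p0 _ Ix; rewrite E2// mulf_eq0 invr_eq0.
  by rewrite (gt_eqF (f1_gt0 _ Ix)) orbF.
- by have := p0 _ Ix; rewrite E2// pmulr_lgt0// invr_gt0 f1_gt0.
- apply/(concave_onP _ itvI) => x y t Ix Iy t01.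
  have := cq _ _ _ Ix Iy t01; rewrite !invf_div.
  by have It := itv_conv itvI Ix Iy t01; rewrite !E1// !E2.
Qed.

Lemma Psi_concave_derivativeP :
  {within I, continuous f} /\
    @concave_on R (R^o * R^o)%type ((f @` I) `*` (f @` I)) (Psi I f) <->
  (continuously_differentiable_on 2 I f /\
    (forall x, I x -> 0 < derive1 f x) /\
    ((forall x, I x -> derive1n 2 f x = 0) \/
     (forall x, I x -> 0 < derive1n 2 f x) /\
     @concave_on R R^o I (fun x => derive1 f x / derive1n 2 f x))).
Proof.
rewrite twice_differentiable_condP continuous_open_subspace//.
split=> [[fc cP]|[f1 [f2 [fD f1D f2c f1_gt0 K]]]].
  have {}fc x : I x -> {for x, continuous f} by move=> Ix; exact/fc/mem_set.
  have := (concave_on_PsiP (image_itv itvI f_incr fc)).1 cP; rewrite -/g => cg.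
  have fD x : I x -> is_derive x 1 f ('D_1 f x).
    by move=> Ix; exact/derivableP/(Psi_concave_derivable oI itvI f_incr
      pinv_incrK fc cg).
  have f1_gt0 x : I x -> 0 < 'D_1 f x.
    by move=> Ix; exact: (Psi_concave_derive_gt0 oI itvI f_incr pinv_incrK fc cg
      Ix (fD _ Ix)).
  have f1D x : I x -> is_derive x 1 (fun x => 'D_1 f x) ('D_1 (fun x =>
    'D_1 f x) x).
    by move=> Ix; exact/derivableP/(Psi_concave_derivable2 oI itvI f_incr
      pinv_incrK fD f1_gt0 cg).
  exists (fun x => 'D_1 f x), (fun x => 'D_1 (fun x => 'D_1 f x) x); split=> //.
    by move=> x; exact: (Psi_concave_continuous2 oI itvI f_incr pinv_incrK fD
      f1_gt0 cg).
  exact/(Psi_concave_square_midconvexP oI itvI f_incr pinv_incrK fD f1D f1_gt0).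
have fc x : I x -> {for x, continuous f} by move=> Ix;
  exact: is_derive_cont (fD _ Ix).
split; first by move=> x /set_mem; exact: fc.
apply/(concave_on_PsiP (image_itv itvI f_incr fc)).
exact/(Psi_concave_square_midconvexP oI itvI f_incr pinv_incrK fD f1D f1_gt0).
Qed.

(** Each term of the weighted sum is bounded by the tangent plane of Psi at the
point of the two weighted averages. *)
Lemma Psi_concave_weighted :
  {within I, continuous f} /\
    @concave_on R (R^o * R^o)%type ((f @` I) `*` (f @` I)) (Psi I f) ->
  forall n : nat, (0 < n)%N -> forall x y : 'I_n -> R,
      (forall i, I (x i)) -> (forall i, I (y i)) ->
      forall l : 'I_n -> R, weights l ->
      weighted_qa_mean I f (fun i => (x i + y i) / 2) l
        <= 2^-1 * (weighted_qa_mean I f x l + weighted_qa_mean I f y l).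
Proof.
rewrite continuous_open_subspace// => -[fc cP] n _ x y Ix Iy l wl.
have {}fc z : I z -> {for z, continuous f} by move=> Iz; exact/fc/mem_set.
have itvJ := image_itv itvI f_incr fc.
have := (concave_on_PsiP itvJ).1 cP; rewrite -/g => cg.
have fD z : I z -> is_derive z 1 f ('D_1 f z).
  by move=> Iz; exact/derivableP/(Psi_concave_derivable oI itvI f_incr
    pinv_incrK fc cg).
have f1_gt0 z : I z -> 0 < 'D_1 f z.
  by move=> Iz; exact: (Psi_concave_derive_gt0 oI itvI f_incr pinv_incrK fc cg
    Iz (fD _ Iz)).
have mean z : (forall i, I (z i)) ->
  [/\ 0 < \sum_(i < n) l i, I (weighted_qa_mean I f z l) &
    \sum_(i < n) l i * f (z i) = (\sum_(i < n) l i) * f (weighted_qa_mean I f z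
      l)].
  move=> Iz; have Jz i : (f @` I) (f (z i)) by exists (z i).
  have [S0 [w Iw wE]] := weighted_mean_in itvJ Jz wl.
  rewrite /weighted_qa_mean -wE (gen_invK itvI f_incr)// wE; split=> //.
  by rewrite mulrC divfK// gt_eqF.
have Im i : I ((x i + y i) / 2) by exact: itv_mid.
have [L0 IX EX] := mean _ Ix; have [_ IY EY] := mean _ Iy;
  have [_ IZ EZ] := mean _ Im.
move: IX EX IY EY IZ EZ.
set X := weighted_qa_mean I f x l; set Y := weighted_qa_mean I f y l.
set Z := weighted_qa_mean I f _ l; set L := \sum_(i < n) l i.
move=> IX EX IY EY IZ EZ; rewrite mulrC -(incr_le f_incr)//;
  last exact: itv_mid.
rewrite -(ler_pM2l L0) -EZ.
set M := f ((X + Y) / 2); set c := 'D_1 f ((X + Y) / 2).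
set a := 'D_1 f X; set b := 'D_1 f Y.
have -> : L * M = \sum_(i < n) (l i * (M - c * (f X / a + f Y / b) / 2) +
    c / a / 2 * (l i * f (x i)) + c / b / 2 * (l i * f (y i))).
  rewrite !big_split/= -mulr_suml -!mulr_sumr EX EY -/L; ring.
apply: ler_sum => i _.
have := Psi_concave_tangent oI itvI pinv_incrK fD f1_gt0 cg IX IY (Ix i) (Iy i).
rewrite -/M -/c -/a -/b => T.
have -> : l i * (M - c * (f X / a + f Y / b) / 2) +
    c / a / 2 * (l i * f (x i)) + c / b / 2 * (l i * f (y i)) =
  l i * (M + c * (((f (x i) - f X) / a + (f (y i) - f Y) / b) / 2)) by ring.
by apply: ler_wpM2l; [case: wl|lra].
Qed.

End equivalences.

Theorem corollary3p5 (R : realType) (I : set R) (f : R -> R)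
  (I_nonempty : I !=set0) (I_open : open I) (I_itv : is_interval I)
  (f_incr : strictly_increasing_on I f) :
  [<->
    (* (a) *)
    forall n : nat, (0 < n)%N -> forall x y : 'I_n -> R,
      (forall i, I (x i)) -> (forall i, I (y i)) ->
      qa_mean I f (fun i => (x i + y i) / 2)
        <= 2^-1 * (qa_mean I f x + qa_mean I f y);
    (* (b) *)
    forall n : nat, (0 < n)%N -> forall x y : 'I_n -> R,
      (forall i, I (x i)) -> (forall i, I (y i)) ->
      forall l : 'I_n -> R, weights l ->
      weighted_qa_mean I f (fun i => (x i + y i) / 2) l
        <= 2^-1 * (weighted_qa_mean I f x l + weighted_qa_mean I f y l);
    (* (c) *)
    forall x y : 'I_2 -> R,
      (forall i, I (x i)) -> (forall i, I (y i)) ->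
      qa_mean I f (fun i => (x i + y i) / 2)
        <= 2^-1 * (qa_mean I f x + qa_mean I f y);
    (* (d) *)
    {within I, continuous f} /\
    @concave_on R (R^o * R^o)%type ((f @` I) `*` (f @` I)) (Psi I f);
    (* (e) *)
    continuously_differentiable_on 2 I f /\
    (forall x, I x -> 0 < derive1 f x) /\
    ((forall x, I x -> derive1n 2 f x = 0) \/
     (forall x, I x -> 0 < derive1n 2 f x) /\
     @concave_on R R^o I (fun x => derive1 f x / derive1n 2 f x))
  ].
Proof.
have ones n : (0 < n)%N -> weights (fun _ : 'I_n => 1 : R).
  by move=> n0; split=> [i|]; [exact: ler01|exists (Ordinal n0);
    exact: oner_neq0].
have cd : (forall x y : 'I_2 -> R, (forall i, I (x i)) -> (forall i, I (y i)) ->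
      qa_mean I f (fun i => (x i + y i) / 2)
        <= 2^-1 * (qa_mean I f x + qa_mean I f y)) ->
    {within I, continuous f} /\
    @concave_on R (R^o * R^o)%type ((f @` I) `*` (f @` I)) (Psi I f).
  move=> /two_point_convexP c.
  have fc x : I x -> {for x, continuous f}.
    by move=> Ix; exact: (two_point_convex_continuous I_open I_itv f_incr c Ix).
  split; first by rewrite continuous_open_subspace// => x /set_mem/fc.
  apply/(concave_on_PsiP (image_itv I_itv f_incr fc)).
  by apply: (two_point_convex_Psi I_open I_itv f_incr _ c); exact: pinv_incrK.
have db := @Psi_concave_weighted _ _ _ I_open I_itv f_incr.
have de := Psi_concave_derivativeP I_open I_itv f_incr.
have ba n : (0 < n)%N -> (forall x y : 'I_n -> R,
      (forall i, I (x i)) -> (forall i, I (y i)) ->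
      forall l : 'I_n -> R, weights l ->
      weighted_qa_mean I f (fun i => (x i + y i) / 2) l
        <= 2^-1 * (weighted_qa_mean I f x l + weighted_qa_mean I f y l)) ->
    forall x y : 'I_n -> R, (forall i, I (x i)) -> (forall i, I (y i)) ->
      qa_mean I f (fun i => (x i + y i) / 2)
        <= 2^-1 * (qa_mean I f x + qa_mean I f y).
  move=> n0 b x y Ix Iy; rewrite -!weighted_qa_mean1.
  exact: b (ones n n0).
tfae.
- by move=> a; apply/db/cd; exact: a.
- by move=> b; apply: ba => //; exact: b.
- exact: cd.
- by move=> /de.
- by move=> /de/db b n n0; apply: ba => //; exact: b.
Qed.
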